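(* Let $M$ be a closed oriented manifold and let $Q\to M$ and $P\to M$ be oriented circle bundles. For $n\in\mathbb{N}$, the set $\mathrm{Cov}_n(Q,P)$ is non-empty if and only if $n\cdot e(Q)=e(P)$ in $H^2(M;\mathbb{Z})$. If it is non-empty, there is a simply-transitive group action of $H^1(M;\mathbb{Z})$ on $\mathrm{Cov}_n(Q,P)$. Hence (in this case) there is a one-to-one correspondence between $\mathrm{Cov}_n(Q,P)$ and $H^1(M;\mathbb{Z})$.
   Context: $\mathbb{N}$ denotes the positive integers and $\mathbb{S}^1=\mathbb{R}/\mathbb{Z}$, written additively. Circle bundles over $M$ come with a simply-transitive $\mathbb{S}^1$-action on the fibers (they are principal $\mathbb{S}^1$-bundles); $e(\cdot)$ denotes the Euler class. A fiberwise $n$-fold covering map $\phi\colon Q\to P$ is a (continuous) map covering the identity of $M$ which on each fiber $Q_p$, $p\in M$, corresponds to the standard $n$-fold covering $\mathbb{S}^1\to\mathbb{S}^1$, $\theta\mapsto n\cdot\theta$, under identifications of $Q_p$ and $P_p$ with $\mathbb{S}^1$ given by the group actions after choosing base elements; equivalently $\phi(\theta\cdot q)=(n\theta)\cdot\phi(q)$ for all $\theta\in\mathbb{S}^1$, $q\in Q$. $\mathrm{Cov}_n(Q,P)$ denotes the set of homotopy classes of fiberwise $n$-fold covering maps $Q\to P$, where homotopies move through fiberwise covering maps. *)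

(* Defs.v *)
From HB Require Import structures.
From mathcomp Require Import all_boot all_order all_algebra.
From mathcomp Require Import all_classical all_reals all_analysis.
Import Order.TTheory GRing.Theory Num.Theory.
Import numFieldNormedType.Exports.
Set Implicit Arguments.
Unset Strict Implicit.
Unset Printing Implicit Defensive.
Local Open Scope classical_set_scope.
Local Open Scope ring_scope.

Definition simplex_set (R : realType) (k : nat) : set 'rV[R]_k.+1 :=
  [set t | (forall i, 0 <= t 0 i) /\ \sum_i t 0 i = 1].

Definition simplex (R : realType) (k : nat) : topologicalType :=
  set_type (@simplex_set R k).

Section Faces.
Variables (R : realType) (k : nat).

Lemma vertex_subproof (i : 'I_k.+1) : delta_mx 0 i \in @simplex_set R k.
Proof.
apply/mem_set; split=> [j|]; first by rewrite mxE ler0n.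
rewrite (bigD1 i) //= big1 ?addr0 ?mxE ?eqxx // => j /negPf ji.
by rewrite mxE ji andbF.
Qed.

Definition vertex (i : 'I_k.+1) : simplex R k :=
  exist (fun t => t \in @simplex_set R k) _ (vertex_subproof i).

Definition insert0 (i : 'I_k.+2) (t : 'rV[R]_k.+1) : 'rV[R]_k.+2 :=
  \row_j oapp (fun l => t 0 l) 0 (unlift i j).

Lemma insert0_lift i t j : insert0 i t 0 (lift i j) = t 0 j.
Proof. by rewrite mxE liftK. Qed.

Lemma insert0_id i t : insert0 i t 0 i = 0.
Proof. by rewrite mxE unlift_none. Qed.

Lemma coface_subproof (i : 'I_k.+2) (t : simplex R k) :
  insert0 i (val t) \in @simplex_set R k.+1.
Proof.
have [t0 t1] := set_valP t.
apply/mem_set; split=> [j|].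
  by case: (unliftP i j) => [l|] ->; rewrite ?insert0_lift ?insert0_id.
rewrite (bigD1 i) //= insert0_id add0r -t1.
rewrite (reindex_omap (lift i) (unlift i)) /=; last first.
  by move=> j; rewrite eq_sym => /unlift_some[l -> ->].
apply: eq_big => [j|j _]; first by rewrite liftK eqxx eq_sym neq_lift.
by rewrite insert0_lift.
Qed.

(** The inclusion of the face opposite to the [i]-th vertex. *)
Definition coface (i : 'I_k.+2) (t : simplex R k) : simplex R k.+1 :=
  exist (fun u => u \in @simplex_set R k.+1) _ (coface_subproof i t).

Lemma coface_continuous i : continuous (coface i).
Proof.
apply: continuous_comp_initial => t.
have ct : {for t, continuous (set_val : simplex R k -> 'rV[R]_k.+1)}.
  exact: initial_continuous.
apply: (@cvg_comp _ _ _ set_val (insert0 i) _ _ _ ct) => U [P nP PU].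
exists (fun a b => P a (lift i b)) => [a b|s /= sP].
  by have := nP a (lift i b); rewrite [a]ord1 insert0_lift.
apply: PU => a j; rewrite ord1; case: (unliftP i j) => [l|] ->.
  by rewrite insert0_lift; exact: sP.
by have := nbhs_singleton (nP 0 i); rewrite !insert0_id.
Qed.

End Faces.

Definition singular (R : realType) (k : nat) (X : topologicalType) :=
  continuousType (simplex R k) X.

Section Compose.
Variables (R : realType) (k : nat) (X : topologicalType).

Lemma face_continuous (i : 'I_k.+2) (s : singular R k.+1 X) :
  continuous (s \o coface i).
Proof.
move=> t; apply: continuous_comp; first exact: coface_continuous.
exact: cts_fun.
Qed.

Definition face (i : 'I_k.+2) (s : singular R k.+1 X) : singular R k X :=
  mkcts (@face_continuous i s).

End Compose.

Section Cohomology.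
Variables (R : realType) (X : topologicalType).

Definition cochain (k : nat) := singular R k X -> int.

Definition coboundary (k : nat) (c : cochain k) : cochain k.+1 :=
  fun s => \sum_(i < k.+2) (-1) ^+ i * c (face i s).

Lemma coboundaryB k : {morph @coboundary k : b c / b - c}.
Proof.
move=> b c; apply/funext => s.
rewrite -[RHS]/(coboundary b s - coboundary c s) /coboundary -sumrB.
by apply: eq_bigr => i _; rewrite mulrBr.
Qed.

Lemma coboundary0 k : @coboundary k 0 = 0.
Proof. by apply/funext => s; rewrite /coboundary big1 // => i _; rewrite mulr0. Qed.

Definition is_cocycle (k : nat) : {pred cochain k} :=
  fun c => `[< coboundary c = 0 >].

Lemma is_cocycle_zmod_closed k : zmod_closed (@is_cocycle k).
Proof.
split=> [|b c /asboolP b0 /asboolP c0]; apply/asboolP.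
  exact: coboundary0.
by rewrite coboundaryB b0 c0 subrr.
Qed.

HB.instance Definition _ k :=
  GRing.isZmodClosed.Build (cochain k) (@is_cocycle k)
    (@is_cocycle_zmod_closed k).

Record cocycle (k : nat) :=
  Cocycle { cocycle_val :> cochain k; _ : cocycle_val \in @is_cocycle k }.

HB.instance Definition _ k := [isSub for @cocycle_val k].
HB.instance Definition _ k := [Choice of cocycle k by <:].
HB.instance Definition _ k := [SubChoice_isSubZmodule of cocycle k by <:].

Definition is_coboundary (k : nat) : {pred cocycle k} :=
  match k return {pred cocycle k} with
  | 0 => fun z => z == 0
  | k'.+1 => fun z => `[< exists b : cochain k', val z = coboundary b >]
  end.

Lemma is_coboundary_zmod_closed k : zmod_closed (@is_coboundary k).
Proof.
case: k => [|k]; split=> /=.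
- exact: eqxx.
- by move=> x y /eqP-> /eqP->; rewrite subr0; exact: eqxx.
- by apply/asboolP; exists 0; rewrite coboundary0.
- move=> x y /asboolP[b xb] /asboolP[c yc]; apply/asboolP.
  by exists (b - c); rewrite coboundaryB -xb -yc [LHS](raddfB val).
Qed.

HB.instance Definition _ k :=
  GRing.isZmodClosed.Build (cocycle k) (@is_coboundary k)
    (@is_coboundary_zmod_closed k).

Definition cohomology (k : nat) : zmodType :=
  Quotient.quot (@is_coboundary k).

Definition cohomology_class (k : nat) (z : cocycle k) : cohomology k :=
  (\pi_(Quotient.quot (@is_coboundary k)) z)%qT.

End Cohomology.

(** [f] restricts to a homeomorphism of [A] onto [B], with inverse [g]. *)
Record homeo_on (X Y : topologicalType) (A : set X) (B : set Y)
    (f : X -> Y) (g : Y -> X) : Prop := HomeoOn {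
  homeo_on_fun : {homo f : x / A x >-> B x};
  homeo_on_inv_fun : {homo g : y / B y >-> A y};
  homeo_on_K : forall x, A x -> g (f x) = x;
  homeo_on_inv_K : forall y, B y -> f (g y) = y;
  homeo_on_continuous : {within A, continuous f};
  homeo_on_inv_continuous : {within B, continuous g} }.

Record closed_manifold (R : realType) (d : nat) (M : topologicalType) : Prop :=
  ClosedManifold {
  manifold_compact : compact [set: M];
  manifold_hausdorff : hausdorff_space M;
  manifold_second_countable : @second_countable M;
  manifold_chart : forall x : M,
    exists (U : set M) (V : set 'rV[R]_d) f g,
      [/\ open U, U x, open V & homeo_on U V f g] }.

Section Orientation.
Variables (R : realType) (M : topologicalType).

(** Singular chains are represented by their coefficients, so the coefficient
    of [t] in the boundary collects all simplices having [t] as a face. *)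
Definition finite_chain (k : nat) (c : singular R k M -> int) : Prop :=
  finite_set [set s | c s != 0].

Definition boundary (k : nat) :
    (singular R k M -> int) -> (singular R k.-1 M -> int) :=
  match k with
  | 0 => fun _ => 0
  | k'.+1 => fun c t =>
      \sum_(i < k'.+2) (-1) ^+ i *
        \sum_(s \in [set s : singular R k'.+1 M | face i s = t]) c s
  end.

Definition chain_off (U : set M) (k : nat) (c : singular R k M -> int) : Prop :=
  forall s, c s != 0 -> forall p, ~ U (s p).

(** Cycles and the homology relation for the pair [(M, ~` U)]. *)
Definition rel_cycle (U : set M) (k : nat) (c : singular R k M -> int) : Prop :=
  finite_chain c /\ chain_off U (boundary c).

Definition rel_homologous (U : set M) (k : nat)
    (c c' : singular R k M -> int) : Prop :=
  exists b : singular R k.+1 M -> int,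
    finite_chain b /\ chain_off U (c - c' - boundary b).

(** [mu x] represents a generator of the local homology group
    [H_d(M, M \ {x}; Z)], and these generators are locally consistent: near any
    point they come from a single class in [H_d(M, M \ U; Z)]. *)
Record orientation (d : nat) (mu : M -> singular R d M -> int) : Prop :=
  Orientation {
  orientation_cycle : forall x, rel_cycle [set x] (mu x);
  orientation_generator : forall x c, rel_cycle [set x] c ->
    exists m : int, rel_homologous [set x] c (mu x *~ m);
  orientation_consistent : forall x, exists (U : set M) c,
    [/\ open U, U x, rel_cycle U c &
        forall y, U y -> rel_homologous [set y] c (mu y)] }.

End Orientation.

Definition integers (R : realType) : {pred R} := fun x => x \is a Num.int.

Lemma integers_zmod_closed (R : realType) : zmod_closed (@integers R).
Proof. by split=> [|x y]; [exact: int_num0 | exact: rpredB]. Qed.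

HB.instance Definition _ (R : realType) :=
  GRing.isZmodClosed.Build R (@integers R) (@integers_zmod_closed R).

Definition circle (R : realType) : Type :=
  quotient_topology (Quotient.quot (@integers R)).

HB.instance Definition _ (R : realType) := Topological.on (circle R).
HB.instance Definition _ (R : realType) :=
  let Q := Quotient.quot (@integers R) in
  GRing.isZmodule.Build (circle R)
    (@addrA Q) (@addrC Q) (@add0r Q) (@addNr Q).

Definition to_circle (R : realType) (x : R) : circle R :=
  (\pi_(Quotient.quot (@integers R)) x)%qT.

(** An orientation of the fibers is the same as the direction of the action.
    Simple transitivity of the action on the fibers is part of local triviality,
    since the local trivializations are equivariant. *)
Record circle_bundle (R : realType) (M : topologicalType) := CircleBundle {
  total :> topologicalType;
  proj : total -> M;
  rot : circle R -> total -> total;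
  proj_continuous : continuous proj;
  rot_continuous : continuous (fun p : circle R * total => rot p.1 p.2);
  rot0 : forall q, rot 0 q = q;
  rotD : forall a b q, rot (a + b) q = rot a (rot b q);
  proj_rot : forall a q, proj (rot a q) = proj q;
  locally_trivial : forall x : M,
    exists (U : set M) (f : total -> M * circle R) g,
      [/\ open U, U x,
          homeo_on (proj @^-1` U) (U `*` [set: circle R]) f g &
          forall q, U (proj q) ->
            (f q).1 = proj q /\ forall a, (f (rot a q)).2 = a + (f q).2] }.

Lemma rot_simply_transitive (R : realType) (M : topologicalType)
    (Q : circle_bundle R M) (q q' : Q) :
  proj q = proj q' -> exists! a, rot a q = q'.
Proof.
move=> qq'; have [U [f [g [_ Ux h fP]]]] := locally_trivial Q (proj q).
have Ux' : U (proj q') by rewrite -qq'.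
exists ((f q').2 - (f q).2); split.
  rewrite -[RHS](homeo_on_K h Ux').
  rewrite -[LHS](homeo_on_K h); last by rewrite /preimage /= proj_rot.
  congr g; apply: injective_projections; last by rewrite (fP _ Ux).2 subrK.
  by rewrite (fP _ Ux').1 (fP _ _).1 proj_rot.
by move=> a <-; rewrite (fP _ Ux).2 addrK.
Qed.

Section Euler.
Variables (R : realType) (M : topologicalType) (Q : circle_bundle R M).

Definition is_lift (k : nat) (s : singular R k M) (l : singular R k Q) : Prop :=
  forall p, proj (l p) = s p.

(** A section of [Q] over the singular 1-skeleton of [M]. *)
Record skeleton_section (l0 : singular R 0 M -> singular R 0 Q)
    (l1 : singular R 1 M -> singular R 1 Q) : Prop := SkeletonSection {
  section_lift0 : forall s, is_lift s (l0 s);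
  section_lift1 : forall s, is_lift s (l1 s);
  section_face : forall s i, face i (l1 s) = l0 (face i s) }.

(** The obstruction to extending the section [l1] over a 2-simplex [s]: trivialize
    [s^* Q] by a lift [l] of [s]; then [l1] over the boundary of [s] becomes a
    map from the boundary of the standard 2-simplex to the circle, whose degree
    is [c s]. On the [i]-th edge this map is written as [to_circle \o theta i],
    and the degree is the signed sum of the increments of the [theta i]. *)
Definition is_obstruction (l1 : singular R 1 M -> singular R 1 Q)
    (c : cochain R M 2) : Prop :=
  forall s : singular R 2 M,
    exists (l : singular R 2 Q) (theta : 'I_3 -> simplex R 1 -> R),
      [/\ is_lift s l,
          forall i, continuous (theta i),
          forall i p, l1 (face i s) p = rot (to_circle (theta i p)) (face i l p) &
          (c s)%:~R = \sum_(i < 3) (-1) ^+ i *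
            (theta i (vertex R 1) - theta i (vertex R 0))].

Definition is_euler_class (e : cohomology R M 2) : Prop :=
  exists l0 l1 (z : cocycle R M 2),
    [/\ skeleton_section l0 l1, is_obstruction l1 (val z) &
        e = cohomology_class z].

(** The obstruction cochain of any section is a cocycle, whose class does not
    depend on the section, so [is_euler_class] holds of exactly one class. *)
Definition euler_class : cohomology R M 2 := xget 0 [set e | is_euler_class e].

End Euler.

Section Coverings.
Variables (R : realType) (M : topologicalType) (n : nat).
Variables (Q P : circle_bundle R M).

Record fiberwise_covering (phi : Q -> P) : Prop := FiberwiseCovering {
  covering_continuous : continuous phi;
  covering_proj : forall q, proj (phi q) = proj q;
  covering_rot : forall a q, phi (rot a q) = rot (a *+ n) (phi q) }.

Definition covering_homotopic (phi psi : Q -> P) : Prop :=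
  exists H : R -> Q -> P,
    [/\ {within `[0, 1]%classic `*` [set: Q],
           continuous (fun p : R * Q => H p.1 p.2)},
        forall t, 0 <= t <= 1 -> fiberwise_covering (H t),
        H 0 = phi & H 1 = psi].

(** The homotopy classes of fiberwise [n]-fold coverings, as a set of sets. *)
Definition Cov : set (set (Q -> P)) :=
  [set A | exists2 phi, fiberwise_covering phi &
             A = [set psi | covering_homotopic phi psi]].

End Coverings.
Arguments Cov {R M} n Q P.

Record simply_transitive_action (G : zmodType) (X : Type) (act : G -> X -> X) :
    Prop := SimplyTransitiveAction {
  action0 : forall x, act 0 x = x;
  actionD : forall g h x, act (g + h) x = act g (act h x);
  action_simply_transitive : forall x y, exists! g, act g x = y }.

(* Main.v *)
From HB Require Import structures.
Require Import Defs.
From mathcomp Require Import all_boot all_order all_algebra.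
From mathcomp Require Import all_classical all_reals all_analysis.
From mathcomp Require Import ring lra zify.
Import Order.TTheory GRing.Theory Num.Theory.
Import numFieldNormedType.Exports.
(* Reimported so that [rot] and [rot0] are those of circle bundles. *)
Import Defs.
Set Implicit Arguments.
Unset Strict Implicit.
Unset Printing Implicit Defensive.
Local Open Scope classical_set_scope.
Local Open Scope ring_scope.

(** Two n-fold coverings Q -> P differ by a map from M to the circle, so they
    form a torsor under such maps, and it remains to classify these up to
    homotopy by the first cohomology.  The increment of a real lift along a path
    turns a map [f] from M to the circle into a real 1-cocycle; subtracting the
    coboundary of a set-theoretic logarithm of [f] makes it integral, and its
    class vanishes exactly when that logarithm can be chosen continuous.
    Conversely a 1-cocycle, integral or real, is the coboundary of a function on
    each contractible open set; on overlaps these functions differ by continuous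
    ones, so a partition of unity glues them to a function [U] on M which has
    the same discontinuities as all of them, and the circle-valued
    exponential of [- U] realizes the class.

    The same gluing constructs a covering when n e(Q) = e(P).  After changing
    the section of P over the 1-skeleton, the obstruction cochains satisfy
    c_P = n c_Q exactly.  Sending the section of Q to that of P defines a
    discontinuous covering, whose increments along paths, measured in local
    trivializations, form a real cocycle; rotating it by the glued function [U]
    makes it continuous. *)

(** The obstacle throughout is to pass between data on singular paths and continuity at points. Two
    facts do this. A function whose increments along the paths of an open set are those of a
    continuous circle-valued map is continuous there, because near points are joined by short paths
    ([potential_continuous]). A cocycle that vanishes on small paths vanishes on all paths
    ([small_cocycle0]). The definition of the obstruction cochain chooses a trivialization over each
    triangle. Pulled back to the total space the cochain becomes the coboundary of one real
    1-cochain, [transgression], and every simplex of M lifts to the total space; so the cocycle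
    property, the independence of the section and the behaviour under coverings reduce to
    computations with increments. Simplices are lifted along [to_circle] and along bundle
    projections by one argument, which uses only local sections and the possibility of translating
    one lift onto another. *)

Lemma continuous_near_eq (T U : topologicalType) (f g : T -> U) (t : T) :
  (\near t, f t = g t) -> {for t, continuous f} -> {for t, continuous g}.
Proof.
move=> fg cf; have ft : f t = g t by exact: nbhs_singleton fg.
rewrite /prop_for /continuous_at -ft.
by apply: cvg_trans cf; apply: near_eq_cvg; apply: filterS fg.
Qed.

Lemma continuous_ext (T U : topologicalType) (f g : T -> U) (t : T) :
  f =1 g -> {for t, continuous f} -> {for t, continuous g}.
Proof. by move=> /funext ->. Qed.

Lemma continuous_pair (T U V : topologicalType) (f : T -> U) (g : T -> V) t :
  {for t, continuous f} -> {for t, continuous g} ->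
  {for t, continuous (fun s => (f s, g s))}.
Proof. by move=> cf cg; apply: cvg_pair. Qed.

Lemma continuous_open_near (T U : topologicalType) (f : T -> U) (A : set U) t :
  {for t, continuous f} -> open A -> A (f t) -> \near t, A (f t).
Proof. by move=> cf oA At; apply: (cf A); exact: open_nbhs_nbhs. Qed.

(** * The circle *)

Section Circle.
Variable R : realType.
Implicit Types (x y : R) (c : circle R).

Lemma to_circleD x y : to_circle (x + y) = to_circle x + to_circle y.
Proof. exact: (raddfD (\pi_(Quotient.quot (@integers R)))%qT). Qed.

Lemma to_circle0 : to_circle 0 = 0 :> circle R.
Proof. exact: (raddf0 (\pi_(Quotient.quot (@integers R)))%qT). Qed.

Lemma to_circle_eq x y : (to_circle x == to_circle y) = (x - y \is a Num.int).
Proof.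
have -> : (x - y \is a Num.int) = _ := Quotient.idealrBE (@integers R) x y.
by apply/eqP/eqP.
Qed.

End Circle.
HB.instance Definition _ (R : realType) :=
  GRing.isNmodMorphism.Build R (circle R) (@to_circle R)
    (conj (@to_circle0 R) (@to_circleD R)).

Section Circle2.
Variable R : realType.
Implicit Types (x y : R) (c : circle R).

Lemma to_circle_int (m : int) : to_circle (m%:~R) = 0 :> circle R.
Proof. by apply/eqP; rewrite -(to_circle0 R) to_circle_eq subr0 intr_int. Qed.

Lemma to_circle_eq0 x : to_circle x = 0 -> exists m : int, x = m%:~R.
Proof.
move/eqP; rewrite -(to_circle0 R) to_circle_eq subr0 => /intrP[m ->].
by exists m.
Qed.

Lemma to_circle_surj c : exists x, to_circle x = c.
Proof.
by exists (repr (c : Quotient.quot (@integers R))); rewrite /to_circle reprK.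
Qed.

Lemma to_circle_continuous : continuous (@to_circle R).
Proof. exact: pi_continuous. Qed.

(** The preimage of the image of [A] is the union of the integer translates of [A]. *)
Lemma to_circle_open (A : set R) : open A -> open (@to_circle R @` A).
Proof.
move=> oA; rewrite /open /= /quotient_open.
rewrite [X in open X](_ : _ =
   \bigcup_(m in [set: int]) ((fun x => x + m%:~R) @^-1` A)).
  apply: bigcup_open => m _; apply: open_comp => // x _.
  by apply: continuousD; [exact: cvg_id|exact: cvg_cst].
apply/seteqP; split=> x /=.
  move=> [y Ay /eqP]; rewrite to_circle_eq => /intrP[m /eqP].
  by rewrite subr_eq => /eqP yE; exists m => //=; rewrite addrC -yE.
move=> [m _ Am]; exists (x + m%:~R) => //.
by rewrite to_circleD to_circle_int addr0.
Qed.

(** Openness of [to_circle] lets neighbourhoods be tested on the line. Addition needs this, since a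
    product of quotient maps need not be a quotient map. *)
Lemma circle_nbhs x (A : set (circle R)) :
  nbhs (to_circle x) A <-> nbhs x (@to_circle R @^-1` A).
Proof.
split=> [|]; first exact: to_circle_continuous.
rewrite nbhsE => -[B [oB Bx] BA].
rewrite nbhsE; exists (@to_circle R @` B); last by move=> _ [y /BA ? <-].
by split; [exact: to_circle_open|exists x].
Qed.

Lemma circle_oppr_continuous : continuous (@GRing.opp (circle R)).
Proof.
move=> c A; have [x <-] := to_circle_surj c; rewrite -raddfN => /circle_nbhs xA.
apply/circle_nbhs.
have : nbhs x (-%R @^-1` (@to_circle R @^-1` A)).
  exact: (@oppr_continuous _ R x _ xA).
by apply: filterS => y /=; rewrite raddfN.
Qed.

Lemma circle_addr_continuous :
  continuous (fun p : circle R * circle R => p.1 + p.2).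
Proof.
move=> [c d] A; have [x <-] := to_circle_surj c; have [y <-] :=
  to_circle_surj d.
rewrite /= -raddfD => /circle_nbhs xA.
have [[B1 B2] /= [xB yB] BA] := @add_continuous _ (x, y) _ xA.
exists (@to_circle R @` B1, @to_circle R @` B2) => /=.
  split; apply/circle_nbhs; [apply: filterS xB|apply: filterS yB] => z Bz;
  by exists z.
move=> [_ _] /= [[x' Bx <-] [y' By <-]].
by have := BA (x', y') (conj Bx By); rewrite /= raddfD.
Qed.

Variable T : topologicalType.
Implicit Types (f g : T -> circle R) (t : T).

Lemma continuous_circleD f g t : {for t, continuous f} ->
  {for t, continuous g} -> {for t, continuous (fun s => f s + g s)}.
Proof.
move=> cf cg.
exact: (continuous_comp (continuous_pair cf cg) (@circle_addr_continuous _)).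
Qed.

Lemma continuous_circleN f t : {for t, continuous f} ->
  {for t, continuous (fun s => - f s)}.
Proof. by move=> cf; exact: continuous_comp cf (@circle_oppr_continuous _). Qed.

Lemma continuous_circleB f g t : {for t, continuous f} ->
  {for t, continuous g} -> {for t, continuous (fun s => f s - g s)}.
Proof. by move=> cf cg; apply/continuous_circleD/continuous_circleN. Qed.

Lemma continuous_circleMn f n t : {for t, continuous f} ->
  {for t, continuous (fun s => f s *+ n)}.
Proof.
move=> cf; elim: n => [|n IH]; first exact: cvg_cst.
rewrite (_ : (fun s => _) = (fun s => f s + f s *+ n)).
  exact: continuous_circleD.
by apply/funext => s; rewrite mulrS.
Qed.

Lemma continuous_to_circle (w : T -> R) t : {for t, continuous w} ->
  {for t, continuous (fun s => to_circle (w s))}.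
Proof. by move=> cw; exact: continuous_comp cw (@to_circle_continuous _). Qed.

End Circle2.

(** With [translatable], this is all the structure that lifting over a box requires. It is shared by
    [to_circle] and the projection of a circle bundle. *)
Definition locally_sectionable (E X : topologicalType) (p : E -> X) :=
  forall x : X, exists (U : set X) (s : X -> E),
    [/\ open U, U x, forall y, U y -> {for y, continuous s} &
        forall y, U y -> p (s y) = y].

(** Two points of a ball of radius 1/2 are less than 1 apart, so [to_circle] is injective on it;
    being open, it has a continuous inverse there. *)
Lemma to_circle_sectionable (R : realType) :
  locally_sectionable (@to_circle R).
Proof.
move=> c; have [a <-] := to_circle_surj c.
pose I : set R := ball a 2^-1.
have oI : open I by exact: ball_open.
have uniqI y z : I y -> I z -> to_circle y = to_circle z -> y = z.
  rewrite /I /ball /= => Iy Iz /eqP; rewrite to_circle_eq => /intrP[m yz].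
  have : `|(m%:~R : R)| < 1.
    rewrite -yz (_ : y - z = (a - z) - (a - y)); last by ring.
    by rewrite (le_lt_trans (ler_normB _ _))// [ltRHS]splitr mul1r ltrD.
  rewrite -intr_norm -[1]/(1%:~R) ltr_int => m1.
  have m0 : m = 0 by lia.
  by apply/eqP; rewrite -subr_eq0 yz m0.
pose s y := xget 0 [set z | I z /\ to_circle z = y].
have sP y : (@to_circle R @` I) y -> I (s y) /\ to_circle (s y) = y.
  by move=> [z Iz zy]; rewrite /s; case: xgetP => [w _ [] //|/(_ z)]; case.
have sK z : I z -> s (to_circle z) = z.
  by move=> Iz; have [|Is sz] := sP (to_circle z); [exists z|exact: uniqI].
exists (@to_circle R @` I), s; split.
- exact: to_circle_open.
- by exists a => //; apply: ballxx.
- move=> _ [z Iz <-] A; rewrite sK// => zA; apply/circle_nbhs.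
  have : nbhs z (I `&` A) by apply: filterI => //; exact: open_nbhs_nbhs.
  by apply: filterS => w [Iw Aw]; rewrite /= sK.
- by move=> y /sP[].
Qed.

(** * Lifting maps from boxes and simplices *)

Lemma continuous_row (R : realType) (T : topologicalType) m (f : T -> 'rV[R]_m)
    t :
  (forall j, {for t, continuous (fun s => f s 0 j)}) -> {for t, continuous f}.
Proof.
move=> cf A [P nP PA].
have : \near t, forall j, P 0 j (f t 0 j) by apply: filter_forall => j; exact:
  cf.
by apply: filterS => s sP; apply: PA => i j; rewrite ord1.
Qed.

Lemma continuous_paste (R : realType) (T U : topologicalType) (h : T -> R)
    (c : R) (f g : T -> U) :
  continuous h -> continuous f -> continuous g ->
  (forall t, h t = c -> f t = g t) ->
  continuous (fun t => if h t <= c then f t else g t).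
Proof.
move=> ch cf cg fg t; have [htc|htc|htc] := ltgtP (h t) c.
- apply: continuous_near_eq (cf t).
  have : \near t, h t < c by exact: (continuous_open_near (ch t) (open_lt (y :=
    c))).
  by apply: filterS => s /ltW ->.
- apply: continuous_near_eq (cg t).
  have : \near t, h t > c by exact: (continuous_open_near (ch t) (open_gt (y :=
    c))).
  by apply: filterS => s; rewrite leNgt => ->.
- move=> A; rewrite htc lexx => nA.
  have : \near t, A (f t) /\ A (g t).
    by apply: filterI; [exact: cf|apply: cg; rewrite -fg].
  by apply: filterS => s [? ?]; rewrite /=; case: ifP.
Qed.

(** Any two lifts of the same map differ by a translation, which can be applied
    to a third one. *)
Definition translatable (E X : topologicalType) (p : E -> X) :=
  forall (T : topologicalType) (u v w : T -> E),
    continuous u -> continuous v -> continuous w -> p \o u = p \o v ->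
    exists w' : T -> E, [/\ continuous w', p \o w' = p \o w &
      forall t, w t = u t -> w' t = v t].

Section Lifting.
Variables (R : realType) (m : nat) (E X : topologicalType) (p : E -> X).
Hypotheses (p_local : locally_sectionable p) (p_trans : translatable p).
Implicit Types (a b x : 'rV[R]_m).

Definition clamp a b x : 'rV[R]_m :=
  \row_i Num.max (a 0 i) (Num.min (b 0 i) (x 0 i)).

Lemma clamp_continuous a b : continuous (clamp a b).
Proof.
move=> x; apply: continuous_row => j.
rewrite (_ : (fun s => clamp a b s 0 j) =
    cst (a 0 j) \max (cst (b 0 j) \min (fun s : 'rV[R]_m => s 0 j))).
  apply: continuous_max; first exact: cst_continuous.
  by apply: continuous_min; [exact: cst_continuous|exact: coord_continuous].
by apply/funext => s; rewrite mxE.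
Qed.

Definition set_coord i (c : R) x : 'rV[R]_m :=
  \row_j if j == i then c else x 0 j.

Lemma set_coord_continuous i c : continuous (set_coord i c).
Proof.
move=> x; apply: continuous_row => j.
have [ji|ji] := eqVneq j i.
  rewrite (_ : (fun s => set_coord i c s 0 j) = (cst c)); first exact:
    cst_continuous.
  by apply/funext => s; rewrite mxE ji eqxx.
rewrite (_ : (fun s => set_coord i c s 0 j) = (fun s => s 0 j)); first exact:
  coord_continuous.
by apply/funext => s; rewrite mxE (negPf ji).
Qed.

Variables (f : 'rV[R]_m -> X) (f_cont : continuous f).

(** Clamping the argument makes the lift a globally defined map, so that no continuity relative to
    the box is involved. *)
Definition lifts_on a b :=
  exists2 s : 'rV[R]_m -> E, continuous s & forall x, p (s x) = f (clamp a b x).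

(** The two lifts may disagree on the cutting hyperplane. Composing both with the projection [pr] to
    this hyperplane spreads the disagreement over the whole space, where [translatable] removes it
    from [r]; then the lifts paste. *)
Lemma lifts_on_split a b i c : a 0 i <= c -> c <= b 0 i ->
  lifts_on a (set_coord i c b) -> lifts_on (set_coord i c a) b -> lifts_on a b.
Proof.
move=> ac cb [s cs sP] [r cr rP].
pose pr := set_coord i c.
have cpr : continuous pr by exact: set_coord_continuous.
have [||//||w [cw wr ws]] := p_trans (u := r \o pr) (v := s \o pr) (w := r).
- by move=> x; apply: continuous_comp; [exact: cpr|exact: cr].
- by move=> x; apply: continuous_comp; [exact: cpr|exact: cs].
- apply/funext => x /=; rewrite rP sP; congr f; apply/rowP => j; rewrite !mxE.
  case: eqP => [->|//]; rewrite (min_idPr cb) maxxx minxx.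
  by rewrite (max_idPr ac).
exists (fun x => if x 0 i <= c then s x else w x).
  apply: continuous_paste => //; first exact: coord_continuous.
  move=> x xc; have prx : pr x = x.
    by apply/rowP => j; rewrite mxE; case: eqP => [->|].
  by rewrite ws /= prx.
move=> x; case: ifPn => [xc|].
  rewrite sP; congr f; apply/rowP => j; rewrite !mxE.
  by case: eqP => [->|//]; rewrite !(min_idPr _)// (le_trans xc).
rewrite -ltNge => /ltW xc; rewrite -[LHS]/((p \o w) x) wr /= rP; congr f.
apply/rowP => j; rewrite !mxE; case: eqP => [->|//].
by rewrite !(max_idPr _)// le_min ?cb ?(le_trans ac cb) ?xc ?(le_trans ac xc).
Qed.

Definition box_le a b := forall j, a 0 j <= b 0 j.

Lemma lifts_on_halve a b (L : R) :
  box_le a b -> (forall j, b 0 j - a 0 j <= L) -> ~ lifts_on a b ->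
  exists a' b', [/\ box_le a a', box_le a' b', box_le b' b,
    (forall j, b' 0 j - a' 0 j <= L / 2) & ~ lifts_on a' b'].
Proof.
move=> ab abL nab.
(* Cut one coordinate at a time: after [k] cuts the first [k] widths are halved. Each cut keeps a
   half without a lift, since lifts of both halves would combine. *)
suff /(_ m (leqnn m)) [a' [b' [? ? ? ? abL2]]] : forall k, (k <= m)%N ->
    exists a' b', [/\ box_le a a', box_le a' b', box_le b' b,
      ~ lifts_on a' b' & forall j : 'I_m,
        b' 0 j - a' 0 j <= if (j < k)%N then L / 2 else L].
  by exists a', b'; split => // j; have := abL2 j; rewrite ltn_ord.
elim=> [_|k IH km]; first by exists a, b; split.
have [a' [b' [aa ab' bb nab' abL2]]] := IH (ltnW km).
pose i := Ordinal km; pose c := (a' 0 i + b' 0 i) / 2.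
have ac : a' 0 i <= c by rewrite /c; have := ab' i; lra.
have cb : c <= b' 0 i by rewrite /c; have := ab' i; lra.
have widthP (u v : 'rV[R]_m) : v 0 i - u 0 i <= L / 2 ->
    (forall j, j != i -> v 0 j - u 0 j = b' 0 j - a' 0 j) ->
    forall j : 'I_m, v 0 j - u 0 j <= if (j < k.+1)%N then L / 2 else L.
  move=> vui vuj j; have [->|ji] := eqVneq j i; first by rewrite ltnS leqnn.
  rewrite vuj// (le_trans (abL2 j))// ltnS [(j <= k)%N]leq_eqVlt.
  by case: eqP => [jk|//]; case/eqP: ji; apply: val_inj; exact: jk.
have := abL2 i; rewrite ltnn => wi.
have [h1|h1] := pselect (lifts_on a' (set_coord i c b')).
  have h2 : ~ lifts_on (set_coord i c a') b'.
    by move=> h2; apply: nab'; apply: lifts_on_split h1 h2.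
  exists (set_coord i c a'), b'; split => //.
  - by move=> j; rewrite mxE; case: eqP => [->|_]; rewrite ?(le_trans _ ac).
  - by move=> j; rewrite mxE; case: eqP => [->|_].
  - apply: widthP => [|j ji]; rewrite mxE ?(negPf ji)// eqxx /c.
    by move: wi; lra.
exists a', (set_coord i c b'); split => //.
- by move=> j; rewrite mxE; case: eqP => [->|_].
- by move=> j; rewrite mxE; case: eqP => [->|_]; rewrite ?(le_trans cb).
- apply: widthP => [|j ji]; rewrite mxE ?(negPf ji)// eqxx /c.
  by move: wi; lra.
Qed.

Lemma lifts_on_small x : exists2 e, 0 < e & forall a b,
  box_le a b -> (forall j, ball (x 0 j) e (a 0 j)) ->
  (forall j, ball (x 0 j) e (b 0 j)) -> lifts_on a b.
Proof.
have [U [s [oU Ux cs sK]]] := p_local (f x).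
have /nbhs_ballP[e /= e0 eU] := continuous_open_near (@f_cont x) oU Ux.
exists e => // a b ab xa xb.
have abU y : U (f (clamp a b y)).
  apply: eU; split=> // i j; rewrite ord1 mxE.
  have := ab j; have := xa j; have := xb j.
  rewrite /ball /= !ltr_norml => /andP[? ?] /andP[? ?] ?; apply/andP.
  case: (leP (b 0 j) (y 0 j)) => h1.
    by rewrite (max_idPr _)//; lra.
  by case: (leP (a 0 j) (y 0 j)) => h2; lra.
exists (s \o (f \o clamp a b)); last by move=> y; rewrite /= sK.
move=> y; apply: continuous_comp; last by apply: cs; exact: abU.
by apply: continuous_comp; [exact: clamp_continuous|exact: f_cont].
Qed.

(** Bisection: a box without a lift contains ever smaller such boxes, whose lower corners cluster at
    a point [x] of the box; near [x] every small box lifts. *)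
Lemma box_lift a b : box_le a b -> lifts_on a b.
Proof.
move=> ab; apply: contrapT => nab.
have [L0 L0P] : exists L, forall j, b 0 j - a 0 j <= L.
  exists (\sum_j (b 0 j - a 0 j)) => j.
  rewrite (bigD1 j)//= lerDl sumr_ge0// => k _.
  by rewrite subr_ge0.
pose bad L (q : 'rV[R]_m * 'rV[R]_m) := [/\ box_le a q.1, box_le q.1 q.2,
  box_le q.2 b, forall j, q.2 0 j - q.1 0 j <= L & ~ lifts_on q.1 q.2].
have [q [q0 qS]] : exists q : nat -> 'rV[R]_m * 'rV[R]_m,
    bad L0 (q 0%N) /\ forall n, bad (L0 / 2 ^+ n) (q n).
  (* Stated for all [q], bad or not, so that the sequence can be defined by plain recursion before
     its badness is proved. *)
  have step q L : {q' | bad L q -> bad (L / 2) q'}.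
    apply: cid; have [[aq qq qb qL nq]|] := pselect (bad L q); last by exists q.
    have [a' [b' [qa' ? b'q ? ?]]] := lifts_on_halve qq qL nq.
    exists (a', b') => _; split => //= j.
      exact: le_trans (aq j) (qa' j).
    exact: le_trans (b'q j) (qb j).
  pose q := fix q (n : nat) := if n is n'.+1 then sval (step (q n') (L0 / 2 ^+
    n')) else (a, b).
  exists q; split=> [|]; first by split=> //= j.
  elim=> [|n IH]; first by rewrite expr0 divr1; split=> //= j.
  rewrite exprSr invfM mulrA /=.
  by case: (step _ _) => q' /= h; exact: h.
have bA j : a 0 j <= b 0 j by exact: ab.
have [|x [_ xcl]] := (@rV_compact R m (fun j => `[a 0 j, b 0 j]%classic)
  (fun j => @segment_compact R (a 0 j) (b 0 j))) ((fun n => (q n).1) @ \oo) _.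
  exists 0%N => // n _ j /=; have [aq qq qb _ _] := qS n.
  by rewrite in_itv /= aq (le_trans (qq j)).
have [e e0 eP] := lifts_on_small x.
have e20 : 0 < e / 2 by rewrite divr_gt0.
have L1 : 0 < `|L0| + 1 by rewrite ltr_wpDl.
have eL0 : 0 < e / 2 / (`|L0| + 1) by rewrite divr_gt0.
(* From [N] on the widths are below [e / 2]. With the lower corner within [e / 2] of [x], both
   corners are within [e]. The denominator [|L0| + 1] stays positive when [L0] is 0. *)
have [N _ NP] := near_infty_natSinv_expn_lt (PosNum eL0).
have [||y [[n /= Nn <-] xn]] := xcl [set (q n).1 | n in [set n |
  (N <= n)%N]] (ball x (e / 2)).
- by exists N => // n /= Nn; exists n.
- exact: nbhsx_ballx.
have [aq qq qb qL nq] := qS n.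
have small : L0 / 2 ^+ n < e / 2.
  have /= := NP n Nn; rewrite ltr_pdivlMr// => h.
  apply: le_lt_trans h; rewrite mul1r mulrC ler_wpM2l ?invr_ge0 ?exprn_ge0//.
  by rewrite (le_trans (ler_norm _))// lerDl.
have xn' j : `|x 0 j - (q n).1 0 j| < e / 2 by case: xn => _ /(_ 0 j).
apply: nq; apply: eP => // j; rewrite /ball /=; have := xn' j.
  by move/lt_trans; apply; lra.
have := qL j; have := qq j; rewrite !ltr_norml => h1 h2 /andP[h3 h4].
by apply/andP; split; lra.
Qed.

End Lifting.

Section RealFunctions.
Variables (R : realType) (T : topologicalType).
Implicit Types (f g : T -> R) (t : T).

Lemma continuous_realD f g t : {for t, continuous f} -> {for t, continuous g} ->
  {for t, continuous (fun s => f s + g s)}.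
Proof. exact: continuousD. Qed.

Lemma continuous_realN f t : {for t, continuous f} ->
  {for t, continuous (fun s => - f s)}.
Proof. exact: continuousN. Qed.

Lemma continuous_realB f g t : {for t, continuous f} -> {for t, continuous g} ->
  {for t, continuous (fun s => f s - g s)}.
Proof. by move=> cf cg; apply/continuous_realD/continuous_realN. Qed.

Lemma continuous_realM f g t : {for t, continuous f} -> {for t, continuous g} ->
  {for t, continuous (fun s => f s * g s)}.
Proof. exact: continuousM. Qed.

Lemma continuous_real_cst (c : R) t : {for t, continuous (fun=> c)}.
Proof. exact: cst_continuous. Qed.

Lemma continuous_real_sum (I : Type) (r : seq I) (F : I -> T -> R) t :
  (forall i, {for t, continuous (F i)}) ->
  {for t, continuous (fun s => \sum_(i <- r) F i s)}.
Proof.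
move=> cF; elim: r => [|i r IH].
  rewrite (_ : (fun s => _) = (fun=> 0)); first exact: continuous_real_cst.
  by apply/funext => s; rewrite big_nil.
rewrite (_ : (fun s => _) = (fun s => F i s + \sum_(j <- r) F j s)).
  exact: continuous_realD.
by apply/funext => s; rewrite big_cons.
Qed.

Lemma continuous_real_max (c : R) f t : {for t, continuous f} ->
  {for t, continuous (fun s => Num.max c (f s))}.
Proof. by move=> cf; apply: continuous_max => //; exact: cst_continuous. Qed.

End RealFunctions.

Lemma locally_constant (R : realType) (F : R -> R) :
  (forall t, \forall s \near t, F s = F t) -> forall a b, F a = F b.
Proof.
move=> Floc a b; apply: is_derive_0_is_cst => t.
apply: (@near_eq_is_derive _ _ _ (cst (F t))).
by apply: filterS (Floc t) => s ->.
Qed.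

Section Simplex.
Variables (R : realType) (k : nat).
Implicit Types (x : 'rV[R]_k.+1) (t u : simplex R k).

Lemma simplex_inj t u : val t = val u -> t = u.
Proof. exact: val_inj. Qed.

Lemma val_simplex_continuous : continuous (val : simplex R k -> 'rV[R]_k.+1).
Proof. exact: initial_continuous. Qed.

Lemma simplex_coord_continuous i : continuous (fun t => val t 0 i : R).
Proof.
move=> t; apply: (continuous_comp (@val_simplex_continuous t)
  (@coord_continuous R _ _ 0 i _)).
Qed.

(** Negative coordinates are cut off. If the remaining sum is below 1, the missing mass goes to the
    vertex 0; otherwise everything is divided by the sum. The denominator is thus never below 1, and
    the retraction extends maps on the simplex to the whole space. *)
Definition retract_fun x : 'rV[R]_k.+1 := \row_j
  ((Num.max 0 (x 0 j) + (j == 0)%:R * Num.max 0 (1 - \sum_i Num.max 0 (x 0 i)))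
    / Num.max 1 (\sum_i Num.max 0 (x 0 i))).

Lemma retract_subproof x : retract_fun x \in @simplex_set R k.
Proof.
apply/mem_set; set S := \sum_i Num.max 0 (x 0 i).
have S1 : 0 < Num.max 1 S by rewrite lt_max ltr01.
split=> [i|].
  rewrite mxE divr_ge0 ?(ltW S1)// addr_ge0 ?le_max ?lexx//.
  by rewrite mulr_ge0 ?ler0n// le_max lexx.
under eq_bigr do rewrite mxE.
rewrite -big_distrl /= big_split /= -/S (bigD1 0)//= mul1r big1 =>
  [|i /negPf->].
  rewrite addr0; case: (leP 1 S) => S1'; last first.
    by rewrite (max_idPr _) ?subr_ge0 ?(ltW S1')// divr1 addrC subrK.
  by rewrite (max_idPl _) ?subr_le0// addr0 divff// gt_eqF// (lt_le_trans
    ltr01).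
by rewrite mul0r.
Qed.

Definition retract x : simplex R k :=
  exist (fun y => y \in @simplex_set R k) _ (retract_subproof x).

Lemma retract_id t : retract (val t) = t.
Proof.
apply: simplex_inj; have [t0 t1] := set_valP t.
have tE i : Num.max 0 (val t 0 i) = val t 0 i by exact/max_idPr/t0.
apply/rowP => j; rewrite mxE.
under eq_bigr do rewrite tE. rewrite t1.
by rewrite tE subrr maxxx mulr0 addr0 maxxx divr1.
Qed.

Lemma retract_continuous : continuous retract.
Proof.
apply: continuous_comp_initial => x; apply: continuous_row => j.
have cmax i : {for x, continuous (fun y : 'rV[R]_k.+1 => Num.max 0 (y 0 i))}.
  by apply: continuous_real_max; exact: coord_continuous.
have cS : {for x, continuous (fun y : 'rV[R]_k.+1 => \sum_i Num.max 0 (y 0 i))}.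
  exact: continuous_real_sum.
apply: (@continuous_ext _ _ (fun y : 'rV[R]_k.+1 =>
  (Num.max 0 (y 0 j) + (j == 0)%:R * Num.max 0 (1 - \sum_i Num.max 0 (y 0 i)))
    / Num.max 1 (\sum_i Num.max 0 (y 0 i)))).
  by move=> y /=; rewrite mxE.
apply: continuous_realM.
  apply: continuous_realD => //; apply: continuous_realM.
    exact: continuous_real_cst.
  apply: continuous_real_max; apply: continuous_realB => //.
  exact: continuous_real_cst.
apply: continuousV; first by rewrite gt_eqF// lt_max ltr01.
exact: continuous_real_max.
Qed.

(** The affine segment, extended to the whole line by the retraction. *)
Definition segment t u (s : R) : simplex R k :=
  retract ((1 - s) *: val t + s *: val u).

Lemma segment0 t u : segment t u 0 = t.
Proof. by rewrite /segment subr0 scale1r scale0r addr0 retract_id. Qed.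

Lemma segment1 t u : segment t u 1 = u.
Proof. by rewrite /segment subrr scale1r scale0r add0r retract_id. Qed.

Lemma segment_continuous t u : continuous (segment t u).
Proof.
move=> s; apply: (@continuous_comp _ _ _
  (fun s : R => (1 - s) *: val t + s *: val u) retract); last first.
  exact: retract_continuous.
apply: continuous_row => j.
apply: (@continuous_ext _ _
    (fun s : R => (1 - s) * val t 0 j + s * val u 0 j)).
  by move=> r; rewrite !mxE.
apply: continuous_realD; apply: continuous_realM => //;
  try exact: continuous_real_cst.
by apply: continuous_realB; [exact: continuous_real_cst|exact: cvg_id].
Qed.

Variables (E X : topologicalType) (p : E -> X).
Hypotheses (p_local : locally_sectionable p) (p_trans : translatable p).

(** Composed with the retraction, [f] lifts over the unit cube, which contains the simplex. *)
Lemma simplex_lift (f : simplex R k -> X) : continuous f ->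
  exists2 s : simplex R k -> E, continuous s & forall t, p (s t) = f t.
Proof.
move=> cf; have cfr : continuous (f \o retract).
  by move=> x; apply: continuous_comp; [exact: retract_continuous|exact: cf].
have [|s cs sP] := box_lift p_local p_trans cfr (a := const_mx 0) (b :=
  const_mx 1).
  by move=> j; rewrite !mxE.
exists (s \o val) => [t|t /=].
  by apply: continuous_comp; [exact: val_simplex_continuous|exact: cs].
rewrite sP /=; congr f; rewrite -[RHS]retract_id; congr retract.
have [t0 t1] := set_valP t; apply/rowP => j; rewrite !mxE.
have tj : val t 0 j <= 1 by rewrite -t1 (bigD1 j)//= lerDl sumr_ge0.
by rewrite (min_idPr tj) (max_idPr _).
Qed.

End Simplex.

Lemma to_circle_translatable (R : realType) : translatable (@to_circle R).
Proof.
move=> T u v w cu cv cw uv; exists (fun t => w t + (v t - u t)); split.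
- by move=> t; exact: (continuous_realD (cw t) (continuous_realB (cv t) (cu
    t))).
- apply/funext => t /=; rewrite raddfD raddfB /=.
  by have /= -> := congr1 (@^~ t) uv; rewrite subrr addr0.
- by move=> t ->; rewrite addrC subrK.
Qed.

Section CircleOnSimplex.
Variables (R : realType) (k : nat).

Lemma circle_lift (g : simplex R k -> circle R) : continuous g ->
  exists2 w : simplex R k -> R, continuous w & forall t, to_circle (w t) = g t.
Proof.
exact: (simplex_lift (@to_circle_sectionable R) (@to_circle_translatable R)).
Qed.

(** Along a segment [w] changes by integers, and by less than 1 locally; hence it is locally
    constant. *)
Lemma lift_of_cst (w : simplex R k -> R) (c : circle R) : continuous w ->
  (forall t, to_circle (w t) = c) -> forall t u, w t = w u.
Proof.
move=> cw wc t u; rewrite -(segment0 t u) -[u in RHS](segment1 t u).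
apply: (@locally_constant R (w \o segment t u)) => s.
have cF : {for s, continuous (w \o segment t u)}.
  by apply: continuous_comp; [exact: segment_continuous|exact: cw].
have : \forall r \near s, ball ((w \o segment t u) s) 1 ((w \o segment t u) r).
  by apply: cF; exact: nbhsx_ballx.
apply: filterS => r; rewrite /ball /=; set x := w _; set y := w _ => xy.
have /eqP : to_circle x = to_circle y by rewrite !wc.
rewrite to_circle_eq => /intrP[m xym]; move: xy; rewrite xym -intr_norm.
rewrite -[ltRHS]/(1%:~R) ltr_int => m1.
have m0 : m = 0 by lia.
by apply/eqP; rewrite eq_sym -subr_eq0 xym m0.
Qed.

End CircleOnSimplex.

(** * Increments of circle-valued paths *)

Section Increment.
Variable R : realType.
Local Notation v0 := (vertex R (0 : 'I_2)).
Local Notation v1 := (vertex R (1 : 'I_2)).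
Implicit Types (g h : simplex R 1 -> circle R).

(** By [circle_lift] and [lift_of_cst] a continuous [g] has exactly one such increment, so the
    default 0 concerns discontinuous [g] only. *)
Definition incr g : R := xget 0 [set x | exists w : simplex R 1 -> R,
  [/\ continuous w, forall t, to_circle (w t) = g t & x = w v1 - w v0]].

Lemma incrE g (w : simplex R 1 -> R) : continuous w ->
  (forall t, to_circle (w t) = g t) -> incr g = w v1 - w v0.
Proof.
move=> cw wg; rewrite /incr; case: xgetP => [_ _ [u [cu ug ->]]|/(_ (w v1 - w
  v0))].
  have := @lift_of_cst _ _ (fun t => u t - w t) 0 _ _ v1 v0.
  have cuw : continuous (fun t => u t - w t).
    by move=> t; exact: (continuous_realB (cu t) (cw t)).
  move=> /(_ cuw) uw; have : u v1 - w v1 = u v0 - w v0.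
    by apply: uw => t; rewrite raddfB /= ug wg subrr.
  lra.
by case; exists w.
Qed.

Lemma incrD g h : continuous g -> continuous h ->
  incr (fun t => g t + h t) = incr g + incr h.
Proof.
move=> /circle_lift[u cu ug] /circle_lift[w cw wh].
rewrite (incrE cu ug) (incrE cw wh) (@incrE _ (fun t => u t + w t)).
- by ring.
- by move=> t; exact: (continuous_realD (cu t) (cw t)).
- by move=> t; rewrite raddfD /= ug wh.
Qed.

Lemma incrB g h : continuous g -> continuous h ->
  incr (fun t => g t - h t) = incr g - incr h.
Proof.
move=> /circle_lift[u cu ug] /circle_lift[w cw wh].
rewrite (incrE cu ug) (incrE cw wh) (@incrE _ (fun t => u t - w t)).
- by ring.
- by move=> t; exact: (continuous_realB (cu t) (cw t)).
- by move=> t; rewrite raddfB /= ug wh.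
Qed.

Lemma incrMn g n : continuous g -> incr (fun t => g t *+ n) = incr g *+ n.
Proof.
move=> /circle_lift[u cu ug].
rewrite (incrE cu ug) (@incrE _ (fun t => u t *+ n)).
- by rewrite mulrnBl.
- move=> t; rewrite (_ : (fun t => _) = (fun t => u t * n%:R)).
    exact: (continuous_realM (cu t) (@continuous_real_cst _ _ n%:R t)).
  by apply/funext => s; rewrite mulr_natr.
- by move=> t; rewrite raddfMn /= ug.
Qed.

Lemma incr_to_circle g : continuous g -> to_circle (incr g) = g v1 - g v0.
Proof.
by move=> /circle_lift[u cu ug]; rewrite (incrE cu ug) raddfB /= !ug.
Qed.

(** A loop that extends over the triangle has degree 0: a lift over the triangle makes the sum
    telescope over the vertices. *)
Lemma incr_face_sum (g : simplex R 2 -> circle R) : continuous g ->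
  \sum_(i < 3) (-1) ^+ i * incr (g \o coface i) = 0.
Proof.
move=> /circle_lift[u cu ug].
have uE i : incr (g \o coface i) = u (coface i v1) - u (coface i v0).
  rewrite (@incrE _ (u \o coface i))//; last by move=> t /=.
  by move=> t; apply: continuous_comp; [exact: coface_continuous|exact: cu].
have cfv (i : 'I_3) (j : 'I_2) : coface i (vertex R j) = vertex R (lift i j).
  apply: simplex_inj; apply/rowP => l /=; case: (unliftP i l) => [l'|] ->.
    by rewrite insert0_lift !mxE (inj_eq lift_inj).
  by rewrite insert0_id mxE (negPf (neq_lift _ _)).
have vE (i j : 'I_3) : i = j :> nat -> vertex R i = vertex R j.
  by move=> ij; congr vertex; exact: val_inj.
rewrite !big_ord_recl big_ord0 !uE !cfv /=.
set a := u (vertex R (lift ord0 1)).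
rewrite (@vE (lift (lift ord0 ord0) 1) (lift ord0 1))// -/a.
rewrite (@vE (lift (lift ord0 (lift ord0 ord0)) 1) (lift ord0 0))//.
rewrite (@vE (lift (lift ord0 (lift ord0 ord0)) 0) (lift (lift ord0 ord0) 0))//.
by rewrite /bump /= expr0 expr1 sqrrN expr1n; ring.
Qed.

End Increment.

(** * Singular simplices and their images under continuous maps *)

Section Singular.
Variables (R : realType) (X : topologicalType) (k : nat).

Definition sing (f : simplex R k -> X) (cf : continuous f) : singular R k X :=
  mkcts cf.

Lemma singular_eq (s s' : singular R k X) : (forall t, s t = s' t) -> s = s'.
Proof. by move=> h; apply/continuousEP. Qed.

Lemma singE f (cf : continuous f) t : sing cf t = f t.
Proof. by []. Qed.

Lemma singular_continuous (s : singular R k X) : continuous s.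
Proof. exact: cts_fun. Qed.

End Singular.

Lemma faceE (R : realType) (X : topologicalType) k (s : singular R k.+1 X) i t :
  face i s t = s (coface i t).
Proof. by []. Qed.

Lemma cohomology_class_eq (R : realType) (X : topologicalType) k
    (z z' : cocycle R X k.+1) :
  cohomology_class z = cohomology_class z' <->
  exists b : cochain R X k, val z - val z' = coboundary b.
Proof.
rewrite /cohomology_class; split=> [/eqP|[b zb]].
  rewrite -Quotient.idealrBE => /asboolP[b]; exists b.
  by rewrite -[LHS](raddfB val).
apply/eqP; rewrite -Quotient.idealrBE; apply/asboolP; exists b.
by rewrite -zb [LHS](raddfB val).
Qed.

Section Push.
Variables (R : realType) (X Y : topologicalType) (k : nat) (f : X -> Y).
Hypothesis cf : continuous f.

Lemma push_subproof (s : singular R k X) : continuous (f \o s).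
Proof.
by move=> t; apply: continuous_comp; [exact: singular_continuous|exact: cf].
Qed.

Definition push (s : singular R k X) : singular R k Y :=
  sing (@push_subproof s).

End Push.

Lemma face_push (R : realType) (X Y : topologicalType) k (f : X -> Y)
    (cf : continuous f) (s : singular R k.+1 X) i :
  face i (push cf s) = push cf (face i s).
Proof. exact: singular_eq. Qed.

(** * Simplicial identities *)

Section NatCoordinates.
Variable R : realType.

(** Coordinates indexed by [nat] make the simplicial identities a matter of
    arithmetic. *)
Definition coord k (t : simplex R k) (l : nat) : R :=
  oapp (fun i => val t 0 i) 0 (insub l).

Lemma coord_ord k (t : simplex R k) (i : 'I_k.+1) : coord t i = val t 0 i.
Proof. by rewrite /coord valK. Qed.

Lemma coord_inj k (t u : simplex R k) : coord t =1 coord u -> t = u.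
Proof.
by move=> tu; apply/simplex_inj/rowP => i; rewrite -!coord_ord tu.
Qed.

Lemma coord_coface k (i : 'I_k.+2) (t : simplex R k) l : coord (coface i t) l =
  if (l < i)%N then coord t l else if l == i then 0 else coord t l.-1.
Proof.
have [lk|lk] := ltnP l k.+2; last first.
  have ik := ltn_ord i.
  have -> : (l < i)%N = false by lia.
  have -> : (l == i) = false by lia.
  by rewrite /coord !insubF//; lia.
rewrite -[l]/(val (Ordinal lk)) coord_ord /=.
case: (unliftP i (Ordinal lk)) => [j|] lE; rewrite lE.
  rewrite insert0_lift -coord_ord.
  have -> : l = bump i j by have /= := congr1 val lE.
  rewrite /bump; case: (leqP i j) => ij.
    by rewrite add1n ltnNge (leq_trans ij)//= gtn_eqF.
  by rewrite add0n ij.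
rewrite insert0_id; have -> : l = i by have /= := congr1 val lE.
by rewrite ltnn eqxx.
Qed.

Lemma coord_vertex k (i : 'I_k.+1) l : coord (vertex R i) l = (l == i)%:R.
Proof.
have [lk|lk] := ltnP l k.+1; last first.
  have -> : (l == i) = false by have := ltn_ord i; lia.
  by rewrite /coord insubF//; lia.
by rewrite -[l]/(val (Ordinal lk)) coord_ord mxE.
Qed.

(** The shifted indices are separate variables tied by equations in [nat], which avoids casts
    between ordinal types. *)
Lemma coface_coface k (i : 'I_k.+3) (j i' : 'I_k.+2) (j' : 'I_k.+3)
    (t : simplex R k) :
  (j < i)%N -> j = j' :> nat -> i = i'.+1 :> nat ->
  coface i (coface j t) = coface j' (coface i' t).
Proof.
move=> ji jj ii; apply: coord_inj => l; rewrite !coord_coface -jj ii.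
case: l => [|l]; do ?[case: ifP => //]; rewrite ?eqxx //; lia.
Qed.

Lemma coface_vertex k (i : 'I_k.+2) (j : 'I_k.+1) (l : 'I_k.+2) :
  l = bump i j :> nat -> coface i (vertex R j) = vertex R l.
Proof.
move=> lE; apply: coord_inj => h; rewrite coord_coface !coord_vertex lE /bump.
case: ltngtP => hi.
- by congr (_%:R); case: leqP => /= ij; lia.
- by congr (_%:R); case: leqP => /= ij; lia.
- by rewrite hi; case: leqP => /= ij; case: eqP => //; lia.
Qed.

Lemma simplex0_eq (t : simplex R 0) : t = vertex R ord0.
Proof.
apply/simplex_inj/rowP => j; rewrite !mxE ord1 eqxx.
by have [_] := set_valP t; rewrite big_ord1.
Qed.

Lemma coord1_sum (t : simplex R 1) : coord t 0 + coord t 1 = 1.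
Proof.
have [_ <-] := set_valP t; rewrite big_ord_recl big_ord1.
by rewrite -2!coord_ord.
Qed.

Lemma coord_simplex_continuous k l : continuous (fun t : simplex R k =>
  coord t l).
Proof.
move=> t; have [lk|lk] := ltnP l k.+1.
  apply: (continuous_ext _ (@simplex_coord_continuous R k (Ordinal lk) t)).
  by move=> u; rewrite -coord_ord.
apply: (continuous_ext _ (@continuous_real_cst _ _ 0 t)).
by move=> u; rewrite /coord insubF// ltnNge lk.
Qed.

Lemma coord_ge0 k (t : simplex R k) l : 0 <= coord t l.
Proof. by rewrite /coord; case: insub => [i|]//=; have [t0 _] := set_valP t.
  Qed.

End NatCoordinates.

(** * Coboundaries of real cochains *)

Section RealCoboundary.
Variables (R : realType) (X : topologicalType).

Definition rcob k (f : singular R k X -> R) (s : singular R k.+1 X) : R :=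
  \sum_(i < k.+2) (-1) ^+ i * f (face i s).

Lemma intr_coboundary k (c : cochain R X k) s :
  (coboundary c s)%:~R = rcob (fun e => (c e)%:~R) s :> R.
Proof.
rewrite rmorph_sum; apply: eq_bigr => i _.
by rewrite rmorphM rmorphXn rmorphN1.
Qed.

Lemma rcob2E (f : singular R 1 X -> R) s :
  rcob f s = f (face 0 s) - f (face 1 s) + f (face 2 s).
Proof.
rewrite /rcob !big_ord_recl big_ord0 /=.
have -> : lift ord0 (ord0 : 'I_2) = 1 :> 'I_3 by exact: val_inj.
have -> : lift ord0 (lift ord0 (ord0 : 'I_1)) = 2 :> 'I_3 by exact: val_inj.
by rewrite /bump /= expr0 expr1 sqrrN expr1n; ring.
Qed.

Lemma face_face k (s : singular R k.+2 X) (i : 'I_k.+3) (j i' : 'I_k.+2)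
    (j' : 'I_k.+3) : (j < i)%N -> j = j' :> nat -> i = i'.+1 :> nat ->
  face j (face i s) = face i' (face j' s).
Proof.
move=> ji jj ii; apply: singular_eq => t.
by rewrite -[LHS]/(s _) -[RHS]/(s _); congr (s _); exact: coface_coface.
Qed.

Lemma rcob_rcob (f : singular R 1 X -> R) s : rcob (rcob f) s = 0.
Proof.
pose F i j := f (face (inord j : 'I_3) (face (inord i : 'I_4) s)).
have -> : rcob (rcob f) s = \sum_(i < 4) (-1) ^+ i * \sum_(j < 3) (-1) ^+ j * F
  i j.
  apply: eq_bigr => i _; congr (_ * _); apply: eq_bigr => j _.
  by rewrite /F !inord_val.
(* The simplicial identity matches the twelve terms in six pairs of opposite sign. *)
have FE i j : (j < i.+1)%N -> (i < 3)%N -> F i.+1 j = F j i.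
  by move=> ji i3; rewrite /F; congr f; apply: face_face; rewrite !inordK//;
    lia.
rewrite !big_ord_recl !big_ord0 /= /bump /= !add1n.
rewrite (FE 0%N 0%N) // (FE 1%N 0%N) // (FE 1%N 1%N) // (FE 2%N 0%N) // (FE 2%N
  1%N) // (FE 2%N 2%N)//.
by ring.
Qed.

Lemma rcobB k (f g : singular R k X -> R) s :
  rcob (fun e => f e - g e) s = rcob f s - rcob g s.
Proof. by rewrite /rcob -sumrB; apply: eq_bigr => i _; rewrite mulrBr. Qed.

Lemma rcobMn k (f : singular R k X -> R) n s :
  rcob (fun e => f e *+ n) s = rcob f s *+ n.
Proof. by rewrite /rcob -sumrMnl; apply: eq_bigr => i _; rewrite mulrnAr. Qed.

Local Notation v0 := (vertex R (0 : 'I_2)).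
Local Notation v1 := (vertex R (1 : 'I_2)).

Lemma triangle_edges (i : 'I_3) (j : 'I_2) : coface i (vertex R j) =
  vertex R (inord (bump i j) : 'I_3).
Proof.
apply: coface_vertex; rewrite inordK// /bump.
by have := ltn_ord i; have := ltn_ord j; case: leqP => /=; lia.
Qed.

(** Nothing is asked of [a]: this is what allows a discontinuous logarithm to correct a cochain to
    integral values without changing its coboundary. *)
Lemma rcob_endpoints (a : X -> R) s : rcob (fun e => a (e v1) - a (e v0)) s = 0.
Proof.
have E i j : face i s (vertex R j) = s (vertex R (inord (bump i j) : 'I_3)).
  by rewrite -triangle_edges.
by rewrite rcob2E !E /bump /=; ring.
Qed.

End RealCoboundary.

Lemma within_open_continuous (X Y : topologicalType) (A : set X) (f : X -> Y) :
  open A ->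
  {within A, continuous f} -> forall x, A x -> {for x, continuous f}.
Proof.
by move=> oA; rewrite continuous_open_subspace// => cf x /mem_set; exact: cf.
Qed.

(** * Circle bundles and the Euler class *)

Section Bundle.
Variables (R : realType) (M : topologicalType) (Q : circle_bundle R M).
Implicit Types (q : Q) (a b : circle R).

Lemma rot_inj q a b : rot a q = rot b q -> a = b.
Proof.
move=> ab; have [|c [_ cU]] := @rot_simply_transitive _ _ Q q (rot b q).
  by rewrite proj_rot.
by rewrite -(cU a ab) -(cU b erefl).
Qed.

(** The quotient of two points of a fiber; the default 0 occurs only for points of different
    fibers. *)
Definition rdiv q q' : circle R := xget 0 [set a | rot a q = q'].

Lemma rdivK q q' : proj q = proj q' -> rot (rdiv q q') q = q'.
Proof.
move=> /rot_simply_transitive[a [aq _]].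
by rewrite /rdiv; case: xgetP => [//|/(_ a)].
Qed.

Lemma rdivE q a : rdiv q (rot a q) = a.
Proof. by apply: (@rot_inj q); rewrite rdivK// proj_rot. Qed.

Lemma rdivqq q : rdiv q q = 0.
Proof. by rewrite -{2}(rot0 q) rdivE. Qed.

Lemma rdivD q q' q'' : proj q = proj q' -> proj q' = proj q'' ->
  rdiv q q'' = rdiv q q' + rdiv q' q''.
Proof.
move=> qq' q'q''; apply: (@rot_inj q).
by rewrite addrC rotD !rdivK// qq'.
Qed.

Lemma rdiv_rotr q q' a : proj q = proj q' -> rdiv q (rot a q') = rdiv q q' + a.
Proof. by move=> qq'; rewrite (rdivD qq') ?proj_rot// rdivE. Qed.

Lemma rdiv_rotl q q' a : proj q = proj q' -> rdiv (rot a q) q' = rdiv q q' - a.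
Proof.
move=> qq'; apply: (@addIr _ a); rewrite subrK addrC -{1}(rdivE q a).
by rewrite -rdivD ?proj_rot.
Qed.

Lemma bundle_sectionable : locally_sectionable (@proj R M Q).
Proof.
move=> x; have [U [f [g [oU Ux h fP]]]] := locally_trivial Q x.
have oUS : open (U `*` [set: circle R]).
  rewrite (_ : _ `*` _ = fst @^-1` U); first by apply: open_comp => // y _;
    exact: cvg_fst.
  by apply/seteqP; split=> -[y a] //= [].
have gU y : U y -> U (proj (g (y, 0))).
  by move=> Uy; exact: (@homeo_on_inv_fun _ _ _ _ _ _ h (y, 0)).
exists U, (fun y => g (y, 0)); split=> // y Uy.
  apply: (@continuous_comp _ _ _ (fun y => (y, 0)) g).
    by apply: continuous_pair; [exact: cvg_id|exact: cvg_cst].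
  exact: (within_open_continuous oUS (homeo_on_inv_continuous h)).
by rewrite -(fP _ (gU _ Uy)).1 (homeo_on_inv_K h).
Qed.

(** In a local trivialization the quotient is the difference of the circle coordinates. *)
Lemma rdiv_continuous (T : topologicalType) (u v : T -> Q) t :
  {for t, continuous u} -> {for t, continuous v} ->
  (\forall s \near t, proj (u s) = proj (v s)) ->
  {for t, continuous (fun s => rdiv (u s) (v s))}.
Proof.
move=> cu cv uv; have [U [f [g [oU Ux h fP]]]] :=
  locally_trivial Q (proj (u t)).
have oV : open (@proj R M Q @^-1` U).
  by apply: open_comp => // q _; exact: proj_continuous.
have uvt : proj (u t) = proj (v t) := nbhs_singleton uv.
have cf w : {for t, continuous w} -> proj (w t) = proj (u t) ->
    {for t, continuous (fun s => (f (w s)).2)}.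
  move=> cw wt; apply: (@continuous_comp _ _ _ (f \o w) snd); last exact:
    cvg_snd.
  apply: continuous_comp cw _.
  by apply: (within_open_continuous oV (homeo_on_continuous h)); rewrite /= wt.
apply: continuous_near_eq (continuous_circleB (cf v cv (esym uvt)) (cf u cu
  erefl)).
have : \forall s \near t, proj (u s) = proj (v s) /\ U (proj (u s)).
  apply: filterI => //; exact: (continuous_open_near cu oV).
apply: filterS => s [uvs Us].
by rewrite -{1}(rdivK uvs) (fP _ Us).2 addrK.
Qed.

Lemma rot_continuous_at (T : topologicalType) (a : T -> circle R) (v : T ->
  Q) t :
  {for t, continuous a} -> {for t, continuous v} ->
  {for t, continuous (fun s => rot (a s) (v s))}.
Proof.
move=> ca cv.
exact: (continuous_comp (continuous_pair ca cv) (@rot_continuous _ _ Q _)).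
Qed.

Lemma bundle_translatable : translatable (@proj R M Q).
Proof.
move=> T u v w cu cv cw uv0.
have uv t : proj (u t) = proj (v t) by have /= := congr1 (@^~ t) uv0.
exists (fun t => rot (rdiv (u t) (v t)) (w t)); split.
- move=> t; apply: (rot_continuous_at (a := fun t =>
    rdiv (u t) (v t)) _ (cw t)).
  by apply: rdiv_continuous; [exact: cu|exact: cv|exact: nearW].
- by apply/funext => t /=; rewrite proj_rot.
- by move=> t ->; rewrite rdivK.
Qed.

Lemma singular_lift k (s : singular R k M) :
  exists l : singular R k Q, is_lift s l.
Proof.
have [l cl lP] := simplex_lift bundle_sectionable bundle_translatable
  (@singular_continuous _ _ _ s).
by exists (sing cl).
Qed.

Definition sproj k : singular R k Q -> singular R k M :=
  push (@proj_continuous _ _ Q).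

Lemma sproj_lift k (s : singular R k M) (l : singular R k Q) :
  is_lift s l -> sproj l = s.
Proof. by move=> sl; exact: singular_eq. Qed.

Lemma rdiv_singular_continuous k (l l' : singular R k Q) :
  (forall t, proj (l t) = proj (l' t)) -> continuous (fun t =>
    rdiv (l t) (l' t)).
Proof.
move=> ll' t; apply: rdiv_continuous; try exact: singular_continuous.
by apply: (@nearW _ (nbhs t)) => s; exact: ll'.
Qed.

Lemma rot_sing_subproof k (a : simplex R k -> circle R) (l : singular R k Q) :
  continuous a -> continuous (fun t => rot (a t) (l t)).
Proof.
move=> ca t; apply: rot_continuous_at; first exact: ca.
exact: singular_continuous.
Qed.

Definition rot_sing k (a : simplex R k -> circle R) (ca : continuous a)
    (l : singular R k Q) : singular R k Q := sing (rot_sing_subproof (l :=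
      l) ca).

End Bundle.

Section Euler.
Variables (R : realType) (M : topologicalType) (Q : circle_bundle R M).
Local Notation v0 := (vertex R (0 : 'I_2)).
Local Notation v1 := (vertex R (1 : 'I_2)).

Definition const_simplex (X : topologicalType) k (x : X) : singular R k X :=
  sing (fun t => @cst_continuous (simplex R k) X x t).

Lemma face_vertex (X : topologicalType) (s : singular R 1 X) (i j : 'I_2) :
  i != j -> face i s = const_simplex 0 (s (vertex R j)).
Proof.
move=> ij; apply: singular_eq => t; rewrite (simplex0_eq t).
rewrite -[LHS]/(s _); congr (s _); apply: coface_vertex.
by case: i ij => -[|[|[]]]//= ? ; case: j => -[|[|[]]].
Qed.

Section Transgression.
Variable l1 : singular R 1 M -> singular R 1 Q.
Hypothesis l1_lift : forall s, is_lift s (l1 s).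

(** The increment of the section [l1] along the path [m] of the total space.
    Its coboundary is the pull-back of the obstruction cochain of [l1]. *)
Definition transgression (m : singular R 1 Q) : R :=
  incr (fun t => rdiv (m t) (l1 (sproj m) t)).

Lemma transgressionE s (m : singular R 1 Q) : is_lift s m ->
  transgression m = incr (fun t => rdiv (m t) (l1 s t)).
Proof. by move=> /sproj_lift sm; rewrite /transgression sm. Qed.

Lemma transgressionB (m m' : singular R 1 Q) : sproj m = sproj m' ->
  transgression m - transgression m' = incr (fun t => rdiv (m t) (m' t)).
Proof.
move=> mm'; have pmm' t : proj (m t) = proj (m' t).
  exact: (congr1 (fun s : singular R 1 M => s t) mm').
rewrite /transgression mm' -incrB; first last.
- by apply: rdiv_singular_continuous => t; rewrite l1_lift.
- by apply: rdiv_singular_continuous => t; rewrite l1_lift.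
congr incr; apply/funext => t.
by rewrite (rdivD (pmm' t) _) ?addrK// l1_lift.
Qed.

(** Two lifts of a triangle differ by a circle-valued map on the whole triangle, whose boundary
    increments cancel. So the coboundary of [transgression] descends to M. *)
Lemma rcob_transgression (m m' : singular R 2 Q) : sproj m = sproj m' ->
  rcob transgression m = rcob transgression m'.
Proof.
move=> mm'; apply/eqP; rewrite -subr_eq0; apply/eqP.
have pmm' t : proj (m t) = proj (m' t).
  exact: (congr1 (fun s : singular R 2 M => s t) mm').
rewrite -(incr_face_sum (rdiv_singular_continuous pmm')) /rcob -sumrB.
apply: eq_bigr => i _; rewrite -mulrBr transgressionB//.
by rewrite /sproj -!face_push -/(sproj m) -/(sproj m') mm'.
Qed.

(** The functions [theta] of the definition are real lifts of the quotients whose increments make up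
    [transgression]. As the lift of the triangle does not matter, the existential over lifts becomes
    an identity for all of them. *)
Lemma is_obstructionP (c : cochain R M 2) : is_obstruction l1 c <->
  forall m : singular R 2 Q, (c (sproj m))%:~R = rcob transgression m.
Proof.
split=> [cP m|cP s].
  have [l [theta [sl ct lt ->]]] := cP (sproj m).
  rewrite -(rcob_transgression (sproj_lift sl)); apply: eq_bigr => i _.
  congr (_ * _); rewrite (@transgressionE (face i (sproj m))); last first.
    by move=> t; rewrite -[RHS]/(sproj m _) -sl.
  rewrite (incrE (ct i))// => t.
  by rewrite lt rdivE.
have [l sl] := singular_lift Q s.
have cl i : continuous (fun t => rdiv (face i l t) (l1 (face i s) t)).
  by apply: rdiv_singular_continuous => t; rewrite l1_lift -[RHS]/(s _) -sl.
pose theta i := sval (cid2 (circle_lift (@cl i))).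
have [ct tP] : (forall i, continuous (theta i)) /\ (forall i t,
    to_circle (theta i t) = rdiv (face i l t) (l1 (face i s) t)).
  by split=> i; rewrite /theta; case: cid2.
exists l, theta; split=> //.
  move=> i t; rewrite tP rdivK// l1_lift -[RHS]/(s _) -sl//.
rewrite -(sproj_lift sl) cP; apply: eq_bigr => i _; congr (_ * _).
rewrite (@transgressionE (face i s)); first by rewrite (incrE (ct i)).
by move=> t; rewrite -[RHS]/(s _) -sl.
Qed.

(** On Q the cochain is a real coboundary, hence closed; every 3-simplex of M lifts to Q. *)
Lemma obstruction_cocycle c : is_obstruction l1 c -> coboundary c = 0.
Proof.
move=> /is_obstructionP cP; apply/funext => s.
have [l /sproj_lift <-] := singular_lift Q s.
apply/eqP; rewrite -(eqr_int R) intr_coboundary; apply/eqP.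
rewrite -[RHS](rcob_rcob transgression l); apply: eq_bigr => i _.
by rewrite face_push cP.
Qed.

End Transgression.

(** So [l0] amounts to a set-theoretic section of Q, through whose values all paths [l1 s] begin and
    end. *)
Lemma section_vertex l0 l1 : @skeleton_section R M Q l0 l1 ->
  forall s j, l1 s (vertex R j) = l0 (const_simplex 0 (s (vertex R j))) (vertex
    R 0).
Proof.
move=> [_ _ lf] s j.
have [i ij] : exists i : 'I_2, i != j.
  by case: j => -[|[|[]]]// ?; [exists 1|exists 0].
by rewrite -(face_vertex s ij) -lf (face_vertex _ ij).
Qed.

Lemma obstruction_exists l0 l1 : @skeleton_section R M Q l0 l1 ->
  exists c : cochain R M 2, is_obstruction l1 c.
Proof.
move=> sl; have [l0P l1P lf] := sl.
pose e x := l0 (const_simplex 0 x) (vertex R 0).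
suff H (m : singular R 2 Q) : exists n : int, n%:~R = rcob (transgression l1) m.
  have lift (s : singular R 2 M) := cid (singular_lift Q s).
  exists (fun s => sval (cid (H (sval (lift s))))).
  apply/is_obstructionP => // m; case: cid => n /= ->.
  apply: rcob_transgression => //; case: (lift _) => l /= sl'.
  exact: sproj_lift.
suff [n ->] : exists n : int, rcob (transgression l1) m = n%:~R by exists n.
apply: to_circle_eq0.
(* Modulo integers the transgression of each edge is the difference of [A] at its endpoints, so the
   alternating sum over the triangle vanishes in the circle. *)
pose A x : circle R := rdiv (m x) (e (proj (m x))).
have tE i : to_circle (transgression l1 (face i m)) =
    A (coface i v1) - A (coface i v0).
  rewrite incr_to_circle; last first.
    by apply: rdiv_singular_continuous => t; rewrite l1P.
  by rewrite !(section_vertex sl).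
rewrite rcob2E raddfD raddfB /= !tE !triangle_edges /bump /=.
set x := A _; set y := A _; set z := A _.
by rewrite opprB [x - y + _]addrC !subrKA subrr.
Qed.

(** The increments [ga] of the quotient of the two sections have coboundary [c' - c], but they are
    real. Subtracting the endpoint differences of a logarithm [a] of the quotient over points makes
    them integral. *)
Lemma obstruction_class l0 l1 l0' l1' c c' :
  @skeleton_section R M Q l0 l1 -> @skeleton_section R M Q l0' l1' ->
  is_obstruction l1 c -> is_obstruction l1' c' ->
  exists b : cochain R M 1, c' - c = coboundary b.
Proof.
move=> sl sl'; have [l0P l1P lf] := sl; have [l0P' l1P' lf'] := sl'.
move=> /(is_obstructionP l1P) cP /(is_obstructionP l1P') cP'.
pose e x := l0 (const_simplex 0 x) (vertex R 0).
pose e' x := l0' (const_simplex 0 x) (vertex R 0).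
pose ga s := incr (fun t => rdiv (l1 s t) (l1' s t)).
have cga s : continuous (fun t => rdiv (l1 s t) (l1' s t)).
  by apply: rdiv_singular_continuous => t; rewrite l1P l1P'.
pose a x := sval (cid (to_circle_surj (rdiv (e x) (e' x)))).
have aP x : to_circle (a x) = rdiv (e x) (e' x) by rewrite /a; case: cid.
have bP (s : singular R 1 M) : exists n : int,
  ga s - (a (s v1) - a (s v0)) = n%:~R.
  apply: to_circle_eq0.
  rewrite raddfB [X in _ - X]raddfB /= !aP incr_to_circle//.
  by rewrite !(section_vertex sl) !(section_vertex sl'); exact: subrr.
pose b s := sval (cid (bP s)).
have bE s : (b s)%:~R = ga s - (a (s v1) - a (s v0)) by rewrite /b; case: cid.
exists b; apply/funext => s; have [m /sproj_lift <-] := singular_lift Q s.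
apply/eqP; rewrite -(eqr_int R) intr_coboundary; apply/eqP.
rewrite rmorphB /= cP cP' -rcobB.
under [RHS]eq_bigr do rewrite bE.
rewrite -[RHS]/(rcob (fun s => ga s - (a (s v1) - a (s v0))) _) [RHS]rcobB.
rewrite (rcob_endpoints a) subr0; apply: eq_bigr => i _; congr (_ * _).
rewrite -incrB; first last.
- by apply: rdiv_singular_continuous => t; rewrite l1P.
- by apply: rdiv_singular_continuous => t; rewrite l1P'.
rewrite face_push; congr incr; apply/funext => t.
rewrite -/(sproj (face i m)) (@rdivD _ _ _ _ (l1 (sproj (face i m)) t)) ?l1P
  ?l1P'//.
by rewrite addrAC subrr add0r.
Qed.

End Euler.

Section EulerClass.
Variables (R : realType) (M : topologicalType) (Q : circle_bundle R M).
Local Notation v0 := (vertex R (0 : 'I_2)).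
Local Notation v1 := (vertex R (1 : 'I_2)).

Lemma coord1_continuous_circle (x y : R) : continuous
  (fun t : simplex R 1 => to_circle (x + coord t 1 * (y - x))).
Proof.
move=> t; apply: (continuous_to_circle
  (continuous_realD (@continuous_real_cst _ _ x t) (continuous_realM
    (@coord_simplex_continuous R 1 1 t) (@continuous_real_cst _ _ (y - x) t)))).
Qed.

(** An arbitrary lift of a path has the wrong endpoints. Rotating it by an angle that interpolates
    linearly between the two required corrections repairs both. *)
Lemma skeleton_section_exists : exists l0 l1, @skeleton_section R M Q l0 l1.
Proof.
pose l0 (s : singular R 0 M) := sval (cid (singular_lift Q s)).
have l0P s : is_lift s (l0 s) by rewrite /l0; case: cid.
pose m (s : singular R 1 M) := sval (cid (singular_lift Q s)).
have mP s : is_lift s (m s) by rewrite /m; case: cid.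
pose e x := l0 (const_simplex R 0 x) (vertex R 0).
have eP x : proj (e x) = x by rewrite l0P.
pose al s j := sval (cid (to_circle_surj (rdiv (m s (vertex R j)) (e (s (vertex
  R j)))))).
have alP s j : to_circle (al s j) = rdiv (m s (vertex R j)) (e (s (vertex R
  j))).
  by rewrite /al; case: cid.
pose l1 s := rot_sing (@coord1_continuous_circle (al s 0) (al s 1)) (m s).
have l1P s : is_lift s (l1 s) by move=> t; rewrite /= proj_rot mP.
exists l0, l1; split=> // s i.
have [j ij] : exists j : 'I_2, i != j.
  by case: i => -[|[|[]]]// ?; [exists 1|exists 0].
rewrite !(face_vertex _ ij); apply: singular_eq => t; rewrite (simplex0_eq t).
transitivity (l1 s (vertex R j)) => //.
transitivity (rot (to_circle (al s j)) (m s (vertex R j))).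
  congr (rot (to_circle _) _); rewrite coord_vertex.
  case: j ij => -[|[|[]]]// j2 _ /=.
    by rewrite mul0r addr0; congr al; exact: val_inj.
  by rewrite mul1r addrC subrK; congr al; exact: val_inj.
by rewrite alP rdivK ?mP ?eP// /e (simplex0_eq (vertex R 0)).
Qed.

(** Winding [l1 s] a further [b s] times around the fiber keeps its endpoints and adds [b s] to its
    transgression. *)
Lemma obstruction_add l0 l1 c (b : cochain R M 1) :
  @skeleton_section R M Q l0 l1 -> is_obstruction l1 c ->
  exists2 l1', @skeleton_section R M Q l0 l1' & is_obstruction l1' (c +
    coboundary b).
Proof.
move=> sl; have [l0P l1P lf] := sl; move=> /(is_obstructionP l1P) cP.
pose l1' s := rot_sing (@coord1_continuous_circle 0 (b s)%:~R) (l1 s).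
have l1P' s : is_lift s (l1' s) by move=> t; rewrite /= proj_rot l1P.
exists l1'.
  split=> // s i; rewrite -lf.
  have [j ij] : exists j : 'I_2, i != j.
    by case: i => -[|[|[]]]// ?; [exists 1|exists 0].
  rewrite !(face_vertex _ ij); congr (const_simplex R 0).
  rewrite -[LHS]/(rot (to_circle _) _) coord_vertex subr0 add0r.
  rewrite [X in rot X _](_ : _ = 0) ?rot0//.
  by case: eqP => _; rewrite ?mul1r ?mul0r ?to_circle_int ?to_circle0.
apply/is_obstructionP => // m.
rewrite -[(_ + _) _]/(c _ + coboundary b _) rmorphD /= cP intr_coboundary.
rewrite -big_split; apply: eq_bigr => i _ /=; rewrite -mulrDr; congr (_ * _).
rewrite [face i (sproj m)]face_push -/(sproj _); set e := face i m.
have cm l : (forall s, is_lift s (l s)) -> continuous (fun t =>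
  rdiv (e t) (l (sproj e) t)).
  by move=> lP; apply: rdiv_singular_continuous => t; rewrite lP.
have -> : (b (sproj e))%:~R = incr (fun t : simplex R 1 =>
  to_circle (0 + coord t 1 * ((b (sproj e))%:~R - 0))).
  rewrite (@incrE R _ (fun t : simplex R 1 => coord t 1 * (b (sproj e))%:~R)).
  - by rewrite !coord_vertex mul1r mul0r subr0.
  - move=> t; exact: (continuous_realM
      (@coord_simplex_continuous R 1 1 t) (@continuous_real_cst _ _ (b (sproj
        e))%:~R t)).
  - by move=> t; rewrite subr0 add0r.
rewrite -incrD; [|exact: cm|exact: coord1_continuous_circle].
by congr incr; apply/funext => t; rewrite -rdiv_rotr ?l1P.
Qed.

Lemma euler_class_exists : exists e, is_euler_class Q e.
Proof.
have [l0 [l1 sl]] := skeleton_section_exists.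
have [c cP] := obstruction_exists sl.
have cz : c \in @is_cocycle R M 2.
  by apply/asboolP; apply: obstruction_cocycle cP => s; exact:
    section_lift1 sl s.
by exists (cohomology_class (Cocycle cz)), l0, l1, (Cocycle cz).
Qed.

Lemma is_euler_class_uniq e e' : is_euler_class Q e -> is_euler_class Q e' ->
  e = e'.
Proof.
move=> [l0 [l1 [z [sl zP ->]]]] [l0' [l1' [z' [sl' zP' ->]]]].
by apply/cohomology_class_eq; exact: (obstruction_class sl' sl).
Qed.

Lemma euler_classP : is_euler_class Q (euler_class Q).
Proof.
rewrite /euler_class; case: xgetP => [e _ //|eP].
by have [e /eP] := euler_class_exists.
Qed.

Lemma euler_classE e : is_euler_class Q e -> euler_class Q = e.
Proof. exact: (is_euler_class_uniq euler_classP). Qed.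

End EulerClass.

Lemma cohomology_classMn (R : realType) (X : topologicalType) k
    (z : cocycle R X k) n : cohomology_class (z *+ n) = cohomology_class z *+ n.
Proof. exact: (raddfMn (\pi_(Quotient.quot (@is_coboundary R X k)))%qT). Qed.

(** * Euler classes and fiberwise coverings *)

Section CoveringEuler.
Variables (R : realType) (M : topologicalType) (n : nat).
Variables (Q P : circle_bundle R M).

Lemma rdiv_covering (phi : Q -> P) (q q' : Q) : fiberwise_covering n phi ->
  proj q = proj q' -> rdiv (phi q) (phi q') = rdiv q q' *+ n.
Proof.
move=> [_ phip phir] qq'; rewrite -{1}(rdivK qq') phir rdiv_rotr//.
by rewrite rdivqq add0r.
Qed.

(** A covering carries a section of Q over the 1-skeleton to one of P and multiplies quotients,
    hence increments, by [n]. *)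
Lemma covering_euler (phi : Q -> P) : fiberwise_covering n phi ->
  euler_class Q *+ n = euler_class P.
Proof.
move=> cphi; have [cont phip phir] := cphi.
have [l0 [l1 [z [sl zP ->]]]] := euler_classP Q.
have [l0P l1P lf] := sl.
symmetry; rewrite -cohomology_classMn; apply: euler_classE.
pose l1' s := push cont (l1 s).
have l1P' s : is_lift s (l1' s) by move=> t; rewrite /= phip l1P.
exists (fun s => push cont (l0 s)), l1', (z *+ n); split=> //.
  split=> // [s t|s i]; first by rewrite /= phip l0P.
  by rewrite face_push lf.
apply/is_obstructionP => // m.
(* The triangle [m] of P need not come from Q; it is replaced by the image of a triangle of Q with
   the same projection, which has the same coboundary of [transgression]. *)
have [m' m'P] := singular_lift Q (sproj m).
have mE : sproj m = sproj (push cont m') by apply: singular_eq => t;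
  rewrite -[RHS]/(proj (phi _)) phip m'P.
rewrite (rcob_transgression l1P' mE) raddfMn /=.
move/(is_obstructionP l1P): zP => /(_ m') zP.
rewrite -[(val z *+ n) _]/((val z *+ n) (sproj m)).
have -> : (val z *+ n) (sproj m) = val z (sproj m) *+ n by rewrite natmulfctE.
rewrite -(sproj_lift m'P) raddfMn /= zP -rcobMn; apply: eq_bigr => i _;
  congr (_ * _).
rewrite /transgression -incrMn; last first.
  by apply: rdiv_singular_continuous => t; rewrite l1P.
congr incr; apply/funext => t; rewrite -(rdiv_covering cphi) ?l1P//.
congr rdiv; rewrite -[LHS]/(phi _); congr (phi (l1 _ t)).
by apply: singular_eq => u; rewrite -[RHS]/(proj (phi _)) phip.
Qed.

Lemma matched_sections : euler_class Q *+ n = euler_class P ->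
  exists l0 l1 l0' l1' (c : cochain R M 2),
    [/\ @skeleton_section R M Q l0 l1, @skeleton_section R M P l0' l1',
      is_obstruction l1 c & is_obstruction l1' (c *+ n)].
Proof.
have [l0 [l1 [z [sl zP ->]]]] := euler_classP Q.
have [l0' [l1' [z' [sl' zP' ->]]]] := euler_classP P.
rewrite -cohomology_classMn => /cohomology_class_eq[b zz'].
have [l1'' sl'' zP''] := obstruction_add b sl' zP'.
exists l0, l1, l0', l1'', (val z); split=> //.
by move: zP''; rewrite -zz' addrC subrK raddfMn.
Qed.

End CoveringEuler.

(** * Potentials of 1-cocycles *)

Section PlanePaths.
Variables (R : realType) (X : topologicalType) (G : R * R -> X).
Hypothesis cG : continuous G.
Implicit Types (a b c : R * R).

Lemma edge_continuous a b : continuous (fun t : simplex R 1 =>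
  G (coord t 0 * a.1 + coord t 1 * b.1, coord t 0 * a.2 + coord t 1 * b.2)).
Proof.
have cc (l : nat) (x : R) t : {for t, continuous (fun t : simplex R 1 =>
  coord t l * x)}.
  exact: (continuous_realM (@coord_simplex_continuous R 1 l t)
    (@continuous_real_cst _ _ x t)).
move=> t; apply: continuous_comp; last exact: cG.
by apply: continuous_pair; apply: continuous_realD; exact: cc.
Qed.

Lemma triangle_continuous a b c : continuous (fun t : simplex R 2 =>
  G (coord t 0 * a.1 + coord t 1 * b.1 + coord t 2 * c.1,
     coord t 0 * a.2 + coord t 1 * b.2 + coord t 2 * c.2)).
Proof.
have cc (l : nat) (x : R) t : {for t, continuous (fun t : simplex R 2 =>
  coord t l * x)}.
  exact: (continuous_realM (@coord_simplex_continuous R 2 l t)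
    (@continuous_real_cst _ _ x t)).
move=> t; apply: continuous_comp; last exact: cG.
by apply: continuous_pair; apply: continuous_realD;
  try apply: continuous_realD; exact: cc.
Qed.

Definition edge a b : singular R 1 X := sing (edge_continuous (a := a) (b :=
  b)).
Definition triangle a b c : singular R 2 X :=
  sing (triangle_continuous (a := a) (b := b) (c := c)).

Lemma face_triangle a b c :
  [/\ face 0 (triangle a b c) = edge b c, face 1 (triangle a b c) = edge a c &
      face 2 (triangle a b c) = edge a b].
Proof.
split; apply: singular_eq => t; rewrite faceE /triangle /edge !singE.
- by rewrite !coord_coface /=; congr (G (_, _)); ring.
- by rewrite !coord_coface /=; congr (G (_, _)); ring.
- by rewrite !coord_coface /=; congr (G (_, _)); ring.
Qed.

Variables (kappa : singular R 1 X -> R).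
Hypothesis kappa0 : forall s : singular R 2 X,
  (forall t, exists p, s t = G p) -> rcob kappa s = 0.

(** The cocycle relation on an affine triangle of the plane. It serves both to compare the sides of
    a square through its diagonal and to subdivide a path. *)
Lemma edge_trans a b c : kappa (edge a c) = kappa (edge a b) + kappa (edge b c).
Proof.
have : rcob kappa (triangle a b c) = 0 by apply: kappa0 => t; eexists.
have [f0 f1 f2] := face_triangle a b c.
by rewrite rcob2E f0 f1 f2; lra.
Qed.

End PlanePaths.

Definition cocycle_on (R : realType) (X : topologicalType) (B : set X)
    (kappa : singular R 1 X -> R) :=
  forall s : singular R 2 X, (forall t, B (s t)) -> rcob kappa s = 0.

(** All faces of the constant triangle are the constant path, so the relation reads k - k + k =
    0. *)
Lemma cocycle_on_const (R : realType) (X : topologicalType) (B : set X)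
    (kappa : singular R 1 X -> R) x :
  cocycle_on B kappa -> B x -> kappa (const_simplex R 1 x) = 0.
Proof.
move=> kB Bx; have := kB (const_simplex R 2 x) (fun=> Bx).
rewrite rcob2E.
have E i : face i (const_simplex R 2 x) = const_simplex R 1 x by exact:
  singular_eq.
by rewrite !E; lra.
Qed.

Record contraction (R : realType) (M : topologicalType) (B : set M) (x : M)
    (C : R * M -> M) : Prop := Contraction {
  contraction_cont : forall p, B p.2 -> {for p, continuous C};
  contraction_in : forall p, B p.2 -> B (C p);
  contraction0 : forall y, B y -> C (0, y) = x;
  contraction1 : forall y, B y -> C (1, y) = y }.

Definition locally_contractible (R : realType) (M : topologicalType) :=
  forall (x : M) (O : set M), open O -> O x -> exists (B : set M) (C : R * M ->
    M),
    [/\ open B, B x, B `<=` O & contraction B x C].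

Definition clamp01 (R : realType) (a : R) : R := Num.max 0 (Num.min 1 a).

Lemma clamp01_continuous (R : realType) : continuous (@clamp01 R).
Proof.
move=> a; apply: continuous_real_max.
by apply: (@continuous_min _ _ (cst 1) id); [exact: cst_continuous|exact:
  cvg_id].
Qed.

Lemma clamp01_itv (R : realType) (a : R) : 0 <= clamp01 a <= 1.
Proof. by rewrite /clamp01 le_max lexx ge_max ler01 ge_min lexx. Qed.

Lemma clamp01_id (R : realType) (a : R) : 0 <= a <= 1 -> clamp01 a = a.
Proof. by move=> /andP[a0 a1]; rewrite /clamp01 (min_idPr a1) (max_idPr a0).
  Qed.

Lemma clamp01_0 (R : realType) : clamp01 0 = 0 :> R.
Proof. by rewrite clamp01_id// lexx ler01. Qed.

Lemma clamp01_1 (R : realType) : clamp01 1 = 1 :> R.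
Proof. by rewrite clamp01_id// lexx ler01. Qed.

(** A ball in a chart is contracted along straight lines to its center; clamping the time keeps the
    points in the ball. *)
Lemma manifold_locally_contractible (R : realType) d (M : topologicalType) :
  closed_manifold R d M -> locally_contractible R M.
Proof.
move=> [_ _ _ charts] x O oO Ox.
have [U [V [f [g [oU Ux oV [fUV gVU gf fg cf cg]]]]]] := charts x.
have cfU := within_open_continuous oU cf.
have cgV := within_open_continuous oV cg.
have Vx : V (f x) by exact: fUV.
have : \forall v \near f x, V v /\ O (g v).
  apply: filterI; first exact: open_nbhs_nbhs.
  by apply: (continuous_open_near (cgV _ Vx) oO); rewrite gf.
move=> /nbhs_ballP[r /= r0 rP].
pose B : set M := [set y | U y /\ ball (f x) r (f y)].
pose h (p : R * M) := f x + clamp01 p.1 *: (f p.2 - f x).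
have hb p : B p.2 -> ball (f x) r (h p).
  move=> [_ [_ bp]]; split=> // i j; have := bp i j; rewrite !mxE /ball /=.
  rewrite opprD addNKr normrN normrM => lr.
  have /andP[c0 c1] := clamp01_itv p.1; rewrite ger0_norm//.
  apply: le_lt_trans lr; rewrite distrC.
  by rewrite -[leRHS]mul1r ler_wpM2r.
exists B, (g \o h); split.
- rewrite openE => y [Uy by_]; apply: filterI; first exact: open_nbhs_nbhs.
  by apply: (cfU _ Uy); apply: open_nbhs_nbhs; split=> //; exact: ball_open.
- by split=> //; exact: ballxx.
- by move=> y [Uy /rP[_]]; rewrite gf.
split.
- move=> p Bp; apply: continuous_comp; last by apply: cgV; exact:
    (rP _ (hb _ Bp)).1.
  apply: continuous_row => j.
  apply: (@continuous_ext _ _ (fun q : R * M =>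
    f x 0 j + clamp01 q.1 * (f q.2 0 j - f x 0 j))); first by move=> q;
      rewrite !mxE.
  apply: continuous_realD; first exact: continuous_real_cst.
  apply: continuous_realM.
    by apply: (@continuous_comp _ _ _ fst); [exact: cvg_fst|exact:
      clamp01_continuous].
  apply: continuous_realB; last exact: continuous_real_cst.
  apply: (@continuous_comp _ _ _ (fun q : R * M => f q.2) (fun v => v 0 j)).
    by apply: (@continuous_comp _ _ _ snd); [exact: cvg_snd|exact: cfU Bp.1].
  exact: coord_continuous.
- move=> p Bp; have [Vh _] := rP _ (hb _ Bp).
  by split=> /=; [exact: gVU|rewrite fg//; exact: hb].
- by move=> y [Uy _]; rewrite /= /h clamp01_0 scale0r addr0 gf.
- by move=> y [Uy _]; rewrite /= /h clamp01_1 scale1r addrC subrK gf.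
Qed.

Lemma segment_coord (R : realType) (t : simplex R 1) :
  segment (vertex R (0 : 'I_2)) (vertex R (1 : 'I_2)) (coord t 1) = t.
Proof.
rewrite /segment -[RHS]retract_id; congr retract; apply/rowP => j.
rewrite !mxE -coord_ord; have := coord1_sum t.
by case: j => -[|[|[]]]//= _; rewrite -?val_eqE /=; lra.
Qed.

Section Contraction.
Variables (R : realType) (M : topologicalType) (B : set M) (x : M) (C :
  R * M -> M).
Hypotheses (Bx : B x) (BC : contraction B x C).
Local Notation v0 := (vertex R (0 : 'I_2)).
Local Notation v1 := (vertex R (1 : 'I_2)).

Lemma ray_subproof y : B y -> continuous (fun t : simplex R 1 =>
  C (coord t 1, y)).
Proof.
move=> By t; apply: (@continuous_comp _ _ _ (fun t : simplex R 1 =>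
  (coord t 1, y))).
  by apply: continuous_pair; [exact: coord_simplex_continuous|exact:
    cst_continuous].
exact: (contraction_cont BC).
Qed.

Definition ray y (By : B y) : singular R 1 M := sing (ray_subproof By).

Lemma contraction_path y : B y -> exists s : singular R 1 M,
  [/\ forall t, B (s t), s v0 = x & s v1 = y].
Proof.
move=> By; exists (ray By); split=> [t||].
- exact: (contraction_in BC).
- by rewrite /ray singE coord_vertex /= (contraction0 BC).
- by rewrite /ray singE coord_vertex /= (contraction1 BC).
Qed.

(** Sweeping a path to the center of the contraction gives a square, one of
    whose sides is constant. *)
Lemma contraction_potential (kappa : singular R 1 M -> R) :
  cocycle_on B kappa -> exists u : M -> R, forall s : singular R 1 M,
    (forall t, B (s t)) -> kappa s = u (s v1) - u (s v0).
Proof.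
move=> kB.
pose u y := if pselect (B y) is left By then kappa (ray By) else 0.
exists u => s sB.
pose G (p : R * R) := C (p.1, s (segment v0 v1 p.2)).
have cG : continuous G.
  move=> p; apply: (@continuous_comp _ _ _
    (fun p : R * R => (p.1, s (segment v0 v1 p.2)))); last by apply:
      (contraction_cont BC); exact: sB.
  apply: continuous_pair; first exact: cvg_fst.
  apply: (@continuous_comp _ _ _ snd (fun b => s (segment v0 v1 b)));
    first exact: cvg_snd.
  apply: (@continuous_comp _ _ _ (segment v0 v1)); first exact:
    segment_continuous.
  exact: singular_continuous.
have GB p : B (G p) by apply: (contraction_in BC); exact: sB.
have k0 (t : singular R 2 M) : (forall a, exists p, t a = G p) ->
  rcob kappa t = 0.
  by move=> tG; apply: kB => a; have [p ->] := tG a.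
have top : edge cG (1, 0) (1, 1) = s.
  apply: singular_eq => t; rewrite /edge singE /G /= !mulr1 mulr0 add0r
    coord1_sum segment_coord.
  by rewrite (contraction1 BC).
have bottom : edge cG (0, 0) (0, 1) = const_simplex R 1 x.
  apply: singular_eq => t; rewrite /edge singE /G /= !mulr0 !addr0.
  by rewrite (contraction0 BC).
have side (b : R) (c : 'I_2) : b = c%:R -> kappa (edge cG (0, b) (1,
  b)) = u (s (vertex R c)).
  move=> bc; rewrite /u; case: pselect => // Bs; congr kappa.
  apply: singular_eq => t; rewrite /edge singE /G /= mulr0 add0r mulr1 -mulrDl
    coord1_sum mul1r.
  congr (C (_, s _)); rewrite bc; case: c bc Bs => -[|[|[]]]//= c2 _ _.
    by rewrite segment0; congr vertex; exact: val_inj.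
  by rewrite segment1; congr vertex; exact: val_inj.
(* Reaching the end of the diagonal along either pair of sides gives
   [u (s v0) + kappa s = 0 + u (s v1)]. *)
have := edge_trans cG k0 (0, 0) (1, 0) (1, 1).
rewrite (edge_trans cG k0 (0, 0) (0, 1) (1, 1)) top bottom.
rewrite (cocycle_on_const kB Bx) (side 0 0)// (side 1 1)//.
by lra.
Qed.

End Contraction.

Section Potential.
Variables (R : realType) (M : topologicalType).
Hypothesis Mlc : locally_contractible R M.
Local Notation v0 := (vertex R (0 : 'I_2)).
Local Notation v1 := (vertex R (1 : 'I_2)).

Lemma locally_path_connected (x : M) (O : set M) : open O -> O x ->
  \forall y \near x, exists s : singular R 1 M,
    [/\ forall t, O (s t), s v0 = x & s v1 = y].
Proof.
move=> oO Ox; have [B [C [oB Bx BO BC]]] := Mlc oO Ox.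
have : \forall y \near x, B y by exact: open_nbhs_nbhs.
apply: filterS => y By; have [s [sB s0 s1]] := contraction_path BC By.
by exists s; split=> // t; exact/BO/sB.
Qed.

Lemma continuous_on_path (X : topologicalType) (f : M -> X) (W : set M) k
    (s : singular R k M) :
  (forall x, W x -> {for x, continuous f}) -> (forall t, W (s t)) ->
  continuous (f \o s).
Proof.
move=> cf sW t; apply: continuous_comp; first exact: singular_continuous.
by apply: cf; exact: sW.
Qed.

(** Near [x] the map [f] has a continuous logarithm [sec \o f]. Its increment along a short path
    from [x] to [y] is [w y - w x], so [w] differs from it by a constant. *)
Lemma potential_continuous (W : set M) (f : M -> circle R) (w : M -> R) :
  open W -> (forall x, W x -> {for x, continuous f}) ->
  (forall s : singular R 1 M, (forall t, W (s t)) ->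
    incr (f \o s) = w (s v1) - w (s v0)) ->
  forall x, W x -> {for x, continuous w}.
Proof.
move=> oW cf fw x Wx.
have [U [sec [oU Ux cs sK]]] := @to_circle_sectionable R (f x).
pose O : set M := W `&` [set y | U (f y)].
have oO : open O.
  rewrite openE => y [Wy Uy]; apply: filterI; first exact: open_nbhs_nbhs.
  exact: (continuous_open_near (cf _ Wy) oU).
have Ox : O x by [].
have cth y : O y -> {for y, continuous (sec \o f)}.
  by move=> [Wy Uy]; apply: continuous_comp; [exact: cf|exact: cs].
apply: (@continuous_near_eq _ _ (fun y => sec (f y) - sec (f x) + w x)).
  apply: filterS (locally_path_connected oO Ox) => y [s [sO s0 s1]].
  have : incr (f \o s) = w (s v1) - w (s v0) by apply: fw => t; exact: (sO t).1.
  rewrite (@incrE _ _ (sec \o f \o s)).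
  - by rewrite /= s0 s1; lra.
  - exact: (continuous_on_path (f := sec \o f) cth).
  - by move=> t; rewrite /= sK//; exact: (sO t).2.
apply: continuous_realD; last exact: continuous_real_cst.
by apply: continuous_realB; [exact: cth|exact: continuous_real_cst].
Qed.

(** By subdivision, the value on the initial segments of a path is locally
    constant. *)
Lemma small_cocycle0 (kappa : singular R 1 M -> R) :
  cocycle_on setT kappa ->
  (forall x, exists2 B : set M, open B /\ B x &
    forall s : singular R 1 M, (forall t, B (s t)) -> kappa s = 0) ->
  forall s, kappa s = 0.
Proof.
move=> kT ksmall s.
pose G (p : R * R) := s (segment v0 v1 p.1).
have cG : continuous G.
  move=> p; apply: (@continuous_comp _ _ _ fst (fun b => s (segment v0 v1 b)));
    first exact: cvg_fst.
  apply: (@continuous_comp _ _ _ (segment v0 v1)); first exact: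
    segment_continuous.
  exact: singular_continuous.
have k0 (t : singular R 2 M) : (forall a, exists p, t a = G p) ->
  rcob kappa t = 0.
  by move=> _; apply: kT.
pose F (a : R) := kappa (edge cG (0, 0) (a, 0)).
have F0 : F 0 = 0.
  have := edge_trans cG k0 (0, 0) (0, 0) (0, 0); rewrite -/(F 0); lra.
have F1 : F 1 = kappa s.
  congr kappa; apply: singular_eq => t; rewrite /edge singE /G /=.
  by rewrite mulr0 add0r mulr1 segment_coord.
rewrite -F1 -F0; apply: locally_constant => a.
have [B [oB Ba] kB] := ksmall (G (a, 0)).
have : \forall p \near (a, 0 : R), B (G p) by exact:
  (continuous_open_near (@cG _) oB).
move=> /nbhs_ballP[e /= e0 eB].
have : \forall b \near a, ball a e b by exact: nbhsx_ballx.
apply: filterS => b ab; rewrite /F (edge_trans cG k0 (0, 0) (a, 0) (b, 0)).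
rewrite [X in _ + X]kB ?addr0// => t; rewrite /edge singE; apply: eB;
  split=> /=.
  have t1 := coord1_sum t; have := coord_ge0 t 0; have := coord_ge0 t 1.
  move=> t0 t0'.
  rewrite /ball /= (_ : a - _ = coord t 1 * (a - b)); last first.
    by rewrite (_ : coord t 0 = 1 - coord t 1); [ring|lra].
  rewrite normrM ger0_norm//; apply: le_lt_trans ab.
  by rewrite -[leRHS]mul1r ler_wpM2r//; lra.
by rewrite !mulr0 addr0; exact: ballxx.
Qed.

End Potential.

(** With [U] the weighted mean of the [u y], the difference [u x - U] is the weighted mean of the
    [u x - u y]. Each term is continuous: on [B y] by hypothesis, elsewhere because its weight
    vanishes nearby. *)
Lemma gluing (R : realType) (M : topologicalType) (B : M -> set M)
    (u : M -> M -> R) :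
  compact [set: M] -> hausdorff_space M ->
  (forall x, open (B x) /\ B x x) ->
  (forall x y z, B x z -> B y z -> {for z, continuous (fun z =>
    u x z - u y z)}) ->
  exists U : M -> R, forall x z, B x z -> {for z, continuous (fun z =>
    u x z - U z)}.
Proof.
move=> Mc Mh Bx uB.
have [[x0 _]|M0] := pselect (exists x : M, True); last first.
  by exists (fun=> 0) => x; case: M0; exists x.
have bump x : exists rho : M -> R, [/\ continuous rho, forall z, 0 <= rho z,
    0 < rho x & forall z, ~ B x z -> \forall y \near z, rho y = 0].
  have [oB Bxx] := Bx x.
  have clx : closed [set x] by exact: (accessible_closed_set1
    (hausdorff_accessible Mh)).
  have clB : closed (~` B x) by exact: open_closedC.
  have xB : [set x] `&` ~` B x = set0.
    by apply/seteqP; split=> // y [-> /(_ Bxx)].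
  have := (@normal_separatorP R M).1 (compact_normal Mh Mc) _ _ clx clB xB.
  move=> /(@uniform_separatorP _ R)[h [ch _ h0 h1]].
  (* The Urysohn function [h] is 0 at [x] and 1 off [B x]. Cutting at 1/2 makes the weight vanish
     near each point off [B x], not merely at it. *)
  exists (fun z => Num.max 0 (2^-1 - h z)); split.
  - move=> z; apply: (@continuous_real_max _ _ 0 (fun z => 2^-1 - h z)).
    by apply: continuous_realB; [exact: continuous_real_cst|exact: ch].
  - by move=> z; rewrite le_max lexx.
  - rewrite (_ : h x = 0) ?subr0 ?lt_max ?invr_gt0 ?ltr0n ?orbT//.
    by apply: h0; exists x.
  - move=> z nB; have h1z : h z = 1 by apply: h1; exists z.
    have : \forall y \near z, 2^-1 < h y.
      apply: (continuous_open_near (ch z) (open_gt (y := 2^-1))).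
      by rewrite /= h1z; lra.
    by apply: filterS => y hy; apply/max_idPl; lra.
pose rho x := sval (cid (bump x)).
have rhoP x : [/\ continuous (rho x), forall z, 0 <= rho x z,
    0 < rho x x & forall z, ~ B x z -> \forall y \near z, rho x y = 0].
  by rewrite /rho; case: cid.
pose MP : ptopologicalType := HB.pack_for ptopologicalType M (isPointed.Build M
  x0).
have Mc' : compact [set: MP] := Mc.
rewrite compact_cover in Mc'.
have [|z _|D _ Dcov] := Mc' M setT (fun x => [set z | 0 < rho x z]).
- by move=> x _; apply: open_comp (open_gt (y := 0)) => z _; have [c _ _ _] :=
    rhoP x; exact: c.
- by exists z => //; have [] := rhoP z.
pose r : seq M := finmap.enum_fset D.
pose S z := \sum_(x <- r) rho x z.
(* The weights are normalized by division, so it suffices that finitely many of the sets where they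
   are positive cover M. *)
have S0 z : 0 < S z.
  have [//|x /= xD rxz] := Dcov z.
  rewrite /S (big_rem x (xD : x \in r)) /= ltr_wpDr// sumr_ge0// => y _.
  by have [_ + _ _] := rhoP y.
exists (fun z => (\sum_(x <- r) rho x z * u x z) / S z) => x z Bxz.
apply: (@continuous_ext _ _ (fun z =>
  (\sum_(y <- r) rho y z * (u x z - u y z)) * (S z)^-1)).
  move=> y; under eq_bigr do rewrite mulrBr.
  rewrite sumrB -big_distrl /= -/(S y) mulrBl; congr (_ - _).
  by rewrite mulrAC mulfV ?mul1r// gt_eqF.
have crho y : {for z, continuous (rho y)} by have [c _ _ _] := rhoP y; exact: c.
apply: continuous_realM; last first.
  by apply: continuousV; [rewrite gt_eqF|apply: continuous_real_sum].
apply: continuous_real_sum => y.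
have [Byz|nByz] := pselect (B y z).
  by apply: continuous_realM => //; exact: uB.
have [_ _ _ /(_ _ nByz) r0] := rhoP y.
apply: (@continuous_near_eq _ _ (fun=> 0)); last exact: continuous_real_cst.
by apply: filterS r0 => q ->; rewrite mul0r.
Qed.

(** * Circle-valued maps and the first cohomology *)

Section CohomologyClass.
Variables (R : realType) (M : topologicalType).
Local Notation v0 := (vertex R (0 : 'I_2)).
Local Notation v1 := (vertex R (1 : 'I_2)).
Implicit Types (f g : M -> circle R) (z : cochain R M 1).

Lemma coboundary_points (b : cochain R M 0) (s : singular R 1 M) :
  coboundary b s = b (const_simplex R 0 (s v1)) - b (const_simplex R 0 (s v0)).
Proof.
rewrite /coboundary 2!big_ord_recl big_ord0 addr0.
rewrite (@face_vertex _ _ s ord0 1)// (@face_vertex _ _ s (lift ord0 ord0) 0)//.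
by rewrite expr0 mul1r expr1 mulN1r.
Qed.

(** [z] measures by how much a set-theoretic logarithm [w] of [f] fails to be a
    continuous one along paths. *)
Definition has_class f z := exists w : M -> R,
  (forall x, to_circle (w x) = f x) /\
  forall s : singular R 1 M, incr (f \o s) = w (s v1) - w (s v0) + (z s)%:~R.

Lemma continuous_sing f k (s : singular R k M) : continuous f ->
  continuous (f \o s).
Proof.
by move=> cf t; apply: continuous_comp; [exact: singular_continuous|exact: cf].
Qed.

Lemma has_class_exists f : continuous f -> exists z, has_class f z.
Proof.
move=> cf; pose w x := sval (cid (to_circle_surj (f x))).
have wP x : to_circle (w x) = f x by rewrite /w; case: cid.
have zP (s : singular R 1 M) : exists m : int,
    incr (f \o s) - (w (s v1) - w (s v0)) = m%:~R.
  apply: to_circle_eq0; rewrite raddfB [X in _ - X]raddfB /= !wP.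
  by rewrite incr_to_circle ?subrr//; exact: continuous_sing.
exists (fun s => sval (cid (zP s))), w; split=> // s.
by case: cid => m /= <-; rewrite addrC subrK.
Qed.

Lemma rcob_incr f (s : singular R 2 M) : continuous f ->
  rcob (fun e : singular R 1 M => incr (f \o e)) s = 0.
Proof. by move=> cf; exact: (incr_face_sum (continuous_sing (s := s) cf)). Qed.

Lemma has_class_cocycle f z : continuous f -> has_class f z ->
  z \in @is_cocycle R M 1.
Proof.
move=> cf [w [_ wz]]; apply/asboolP/funext => s.
apply/eqP; rewrite -(eqr_int R) intr_coboundary; apply/eqP.
transitivity (rcob (fun e : singular R 1 M =>
    incr (f \o e) - (w (e v1) - w (e v0))) s).
  by apply: eq_bigr => i _; rewrite wz [X in _ = _ * X]addrC addKr.
by rewrite rcobB rcob_incr// (rcob_endpoints w) subrr.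
Qed.

Lemma has_classD f g z z' : continuous f -> continuous g ->
  has_class f z -> has_class g z' -> has_class (fun x => f x + g x) (z + z').
Proof.
move=> cf cg [w [wf wz]] [w' [wg wz']]; exists (fun x => w x + w' x); split.
  by move=> x; rewrite raddfD /= wf wg.
move=> s; rewrite -[(z + z') s]/(z s + z' s) rmorphD /=.
transitivity (incr (f \o s) + incr (g \o s)).
  by rewrite -incrD//; exact: continuous_sing.
by rewrite wz wz'; ring.
Qed.

Lemma has_classB f g z z' : continuous f -> continuous g ->
  has_class f z -> has_class g z' -> has_class (fun x => f x - g x) (z - z').
Proof.
move=> cf cg [w [wf wz]] [w' [wg wz']]; exists (fun x => w x - w' x); split.
  by move=> x; rewrite raddfB /= wf wg.
move=> s; rewrite -[(z - z') s]/(z s - z' s) rmorphB /=.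
transitivity (incr (f \o s) - incr (g \o s)).
  by rewrite -incrB//; exact: continuous_sing.
by rewrite wz wz'; ring.
Qed.

(** Two set-theoretic logarithms of [f] differ by an integer-valued function, that is, a
    0-cochain. *)
Lemma has_class_eq f z z' : has_class f z -> has_class f z' ->
  exists b : cochain R M 0, z - z' = coboundary b.
Proof.
move=> [w [wf wz]] [w' [wf' wz']].
have aP x : exists m : int, w' x - w x = m%:~R.
  by apply: to_circle_eq0; rewrite raddfB /= wf wf' subrr.
pose a x := sval (cid (aP x)).
have aE x : (a x)%:~R = w' x - w x by rewrite /a; case: cid.
exists (fun p => a (p (vertex R 0))); apply/funext => s;
  rewrite coboundary_points /=.
rewrite -[LHS]/(z s - z' s) -[RHS]/(a (s v1) - a (s v0)).
apply/eqP; rewrite -(eqr_int R) !rmorphB /= !aE; apply/eqP.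
by have := wz s; rewrite wz'; lra.
Qed.

Lemma has_class_coboundary f z (b : cochain R M 0) :
  has_class f z -> has_class f (z + coboundary b).
Proof.
move=> [w [wf wz]].
exists (fun x => w x - (b (const_simplex R 0 x))%:~R); split.
  by move=> x; rewrite raddfB /= wf to_circle_int subr0.
move=> s; rewrite wz -[(z + _) s]/(z s + coboundary b s) rmorphD /=.
by rewrite coboundary_points rmorphB /=; ring.
Qed.

Hypothesis Mlc : locally_contractible R M.

Lemma has_class0_log f : continuous f -> has_class f 0 ->
  exists2 w : M -> R, continuous w & forall x, to_circle (w x) = f x.
Proof.
move=> cf [w [wf w0]]; exists w => // x.
apply: (@potential_continuous R M Mlc setT f w) => //; first exact: openT.
  by move=> y _; exact: cf.
by move=> s _; rewrite w0 addr0.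
Qed.

Hypotheses (Mc : compact [set: M]) (Mh : hausdorff_space M).

(** Normalized to vanish at the center, the local potentials of the integral cocycle are
    integer-valued. Hence [- U] and [u x - U] have the same image in the circle, though only the
    latter is known to be continuous. *)
Lemma has_class_surj z : coboundary z = 0 ->
  exists2 f : M -> circle R, continuous f & has_class f z.
Proof.
move=> z0; pose ka (s : singular R 1 M) : R := (z s)%:~R.
have kaT : cocycle_on setT ka.
  by move=> s _; rewrite -intr_coboundary z0.
have loc x : exists Bu : set M * (M -> R), [/\ open Bu.1, Bu.1 x,
    forall s : singular R 1 M, (forall t, Bu.1 (s t)) ->
      ka s = Bu.2 (s v1) - Bu.2 (s v0) &
    forall y, Bu.1 y -> to_circle (Bu.2 y) = 0].
  have [B [C [oB Bx _ BC]]] := Mlc openT (I : setT x).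
  have [|u uP] := contraction_potential Bx BC (kappa := ka); first
    by move=> s _; exact: kaT.
  exists (B, fun y => u y - u x); split=> //= [s sB|y By].
    by rewrite (uP _ sB); ring.
  have [s [sB <- <-]] := contraction_path BC By.
  by rewrite -(uP _ sB) to_circle_int.
pose B x := (sval (cid (loc x))).1; pose u x := (sval (cid (loc x))).2.
have BuP x : [/\ open (B x), B x x,
    forall s : singular R 1 M, (forall t, B x (s t)) ->
      ka s = u x (s v1) - u x (s v0) &
    forall y, B x y -> to_circle (u x y) = 0].
  by rewrite /B /u; case: cid.
have [||U UP] := gluing (R := R) (B := B) (u := u) Mc Mh.
- by move=> x; have [] := BuP x.
- move=> x y q Bxq Byq; have [oBx _ ux _] := BuP x; have [oBy _ uy _] := BuP y.
  (* Two potentials of the same cocycle have equal increments, so their difference has those of a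
     constant map. *)
  apply: (@potential_continuous R M Mlc (B x `&` B y) (fun=> 0)) => //.
  + exact: openI.
  + by move=> p _; exact: cvg_cst.
  + move=> s sB; rewrite (@incrE _ _ (fun=> 0)).
    * rewrite subrr.
      have := ux s (fun t => (sB t).1); rewrite (uy s (fun t => (sB t).2)).
      by lra.
    * by move=> t; exact: continuous_real_cst.
    * by move=> t /=; rewrite to_circle0.
pose f x := to_circle (- U x).
have fE x y : B x y -> f y = to_circle (u x y - U y).
  by move=> Bxy; have [_ _ _ ux] := BuP x; rewrite raddfD /= ux// add0r.
have cf : continuous f.
  move=> x; have [oB Bx _ _] := BuP x.
  apply: (@continuous_near_eq _ _ (fun y => to_circle (u x y - U y))).
    have : \forall y \near x, B x y by exact: open_nbhs_nbhs.
    by apply: filterS => y By; rewrite (fE x).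
  exact: (continuous_to_circle (UP x x Bx)).
exists f => //; exists (fun x => - U x); split=> // s.
(* The defect [k] is a cocycle, and it vanishes on paths inside some [B x], where [u x - U] is a
   continuous logarithm of [f]. *)
pose k (s : singular R 1 M) := incr (f \o s) - ((- U (s v1)) - (- U (s v0))) -
  ka s.
suff : k s = 0 by rewrite /k -/(ka s); lra.
apply: (@small_cocycle0 R M k).
  move=> t _; rewrite /k rcobB rcobB rcob_incr// (rcob_endpoints (fun x =>
    - U x)).
  by rewrite kaT// !subrr.
move=> x; have [oB Bx ux u0] := BuP x; exists (B x) => // t tB.
rewrite /k (ux _ tB) (@incrE _ _ ((fun y => u x y - U y) \o t)).
- by rewrite /=; lra.
- exact: (continuous_on_path (UP x) tB).
- by move=> p; rewrite /= -(fE x).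
Qed.

End CohomologyClass.

(** * Coverings *)

Section Coverings.
Variables (R : realType) (M : topologicalType) (n : nat).
Variables (Q P : circle_bundle R M).
Implicit Types (phi psi chi : Q -> P).
Local Notation v0 := (vertex R (0 : 'I_2)).
Local Notation v1 := (vertex R (1 : 'I_2)).

Lemma fiber_point (x : M) : exists q : Q, proj q = x.
Proof.
by have [U [s [_ Ux _ sK]]] := @bundle_sectionable R M Q x; exists (s x);
  exact: sK.
Qed.

Definition pt (x : M) : Q := sval (cid (fiber_point x)).

Lemma proj_pt x : proj (pt x) = x.
Proof. by rewrite /pt; case: cid. Qed.

(** The point [pt x] of the fiber is arbitrary. For two [n]-fold coverings any other point gives the
    same value, since both turn by the same multiple; a local section can thus replace [pt] to show
    continuity. *)
Definition diff phi psi (x : M) : circle R := rdiv (phi (pt x)) (psi (pt x)).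

Lemma diffE phi psi q : fiberwise_covering n phi -> fiberwise_covering n psi ->
  diff phi psi (proj q) = rdiv (phi q) (psi q).
Proof.
move=> [_ pphi rphi] [_ ppsi rpsi]; rewrite /diff.
have pq : proj q = proj (pt (proj q)) by rewrite proj_pt.
rewrite -(rdivK pq) rphi rpsi rdiv_rotl ?rdiv_rotr ?proj_rot ?pphi ?ppsi//.
by rewrite addrK.
Qed.

Lemma rot_diff phi psi q : fiberwise_covering n phi ->
  fiberwise_covering n psi ->
  rot (diff phi psi (proj q)) (phi q) = psi q.
Proof.
move=> cphi cpsi; rewrite diffE// rdivK//.
by rewrite (covering_proj cphi) (covering_proj cpsi).
Qed.

Lemma diff_continuous phi psi : fiberwise_covering n phi ->
  fiberwise_covering n psi -> continuous (diff phi psi).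
Proof.
move=> cphi cpsi x.
have [U [s [oU Ux cs sK]]] := @bundle_sectionable R M Q x.
apply: (@continuous_near_eq _ _ (fun y => rdiv (phi (s y)) (psi (s y)))).
  have : \forall y \near x, U y by exact: open_nbhs_nbhs.
  by apply: filterS => y Uy; rewrite -diffE// sK.
apply: rdiv_continuous.
- exact: (continuous_comp (cs _ Ux) (@covering_continuous _ _ _ _ _ _ cphi _)).
- exact: (continuous_comp (cs _ Ux) (@covering_continuous _ _ _ _ _ _ cpsi _)).
- apply: (@nearW _ (nbhs x)) => y.
  by rewrite (covering_proj cphi) (covering_proj cpsi).
Qed.

Lemma diffD phi psi chi x : fiberwise_covering n phi ->
  fiberwise_covering n psi ->
  fiberwise_covering n chi -> diff phi chi x = diff phi psi x + diff psi chi x.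
Proof.
move=> [_ pphi _] [_ ppsi _] [_ pchi _].
by rewrite /diff -rdivD// ?pphi ?ppsi ?pchi.
Qed.

Lemma rotate_covering phi (f : M -> circle R) : fiberwise_covering n phi ->
  continuous f -> fiberwise_covering n (fun q => rot (f (proj q)) (phi q)).
Proof.
move=> [cphi pphi rphi] cf; split.
- move=> q; apply: (rot_continuous_at (a := fun q => f (proj q))); last exact:
    cphi.
  exact: (continuous_comp (@proj_continuous _ _ Q q) (@cf _)).
- by move=> q; rewrite proj_rot.
- by move=> a q; rewrite proj_rot rphi -!rotD addrC.
Qed.

Lemma diff_rotate phi (f : M -> circle R) : diff phi (fun q =>
  rot (f (proj q)) (phi q)) = f.
Proof. by apply/funext => x; rewrite /diff rdivE proj_pt. Qed.

(** The increment [w x] of the difference along the track of the homotopy over [x] is a logarithm of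
    [diff phi psi]. Sweeping a path through the homotopy gives a square whose side at time 0 is
    constant; it shows that the increments of the two agree. *)
Lemma homotopic_has_class0 phi psi : covering_homotopic n phi psi ->
  has_class (diff phi psi) 0.
Proof.
move=> [H [cH covH H0 H1]].
have in01 (t : R) : 0 <= clamp01 t <= 1 by exact: clamp01_itv.
have cov t : fiberwise_covering n (H (clamp01 t)) by exact: covH.
have cphi : fiberwise_covering n phi by rewrite -H0; apply: covH;
  rewrite lexx ler01.
have cpsi : fiberwise_covering n psi by rewrite -H1; apply: covH;
  rewrite lexx ler01.
(* The homotopy is continuous on [0, 1] only; clamping the time extends it continuously to the
   line. *)
pose Hc (p : R * Q) := H (clamp01 p.1) p.2.
have cHc : continuous Hc.
  move=> p.
  pose c (p : R * Q) := (clamp01 p.1, p.2).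
  have cc : {for p, continuous c}.
    apply: continuous_pair; last exact: cvg_snd.
    by apply: (@continuous_comp _ _ _ fst); [exact: cvg_fst|exact:
      clamp01_continuous].
  have cA q : (`[0, 1]%classic `*` [set: Q]) (c q).
    by split=> //=; rewrite in_itv /= in01.
  move/subspace_continuousP: cH => /(_ (c p) (cA p)) cH A HA.
  have := cc _ (cH A HA); rewrite /nbhs /=.
  by apply: filterS => q /(_ (cA q)).
pose D (t : R) (x : M) := diff phi (H (clamp01 t)) x.
have DE t q : D t (proj q) = rdiv (phi q) (Hc (t, q)) by rewrite /D diffE.
have cray x : continuous (fun t : simplex R 1 => D (coord t 1) x).
  move=> t; rewrite -(proj_pt x).
  apply: (@continuous_ext _ _ (fun t : simplex R 1 =>
    rdiv (phi (pt x)) (Hc (coord t 1, pt x)))).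
    by move=> t'; rewrite DE.
  apply: rdiv_continuous; first exact: cst_continuous.
    apply: (@continuous_comp _ _ _ (fun t : simplex R 1 => (coord t 1, pt x)));
      last exact: cHc.
    by apply: continuous_pair; [exact: coord_simplex_continuous|exact:
      cst_continuous].
  apply: (@nearW _ (nbhs t)) => t'.
  by rewrite (covering_proj cphi) (covering_proj (cov _)).
pose w x := incr (fun t : simplex R 1 => D (coord t 1) x).
exists w; split=> [x|s].
  rewrite incr_to_circle// !coord_vertex /D clamp01_1 clamp01_0 H0 H1.
  by rewrite [X in _ - X]/diff rdivqq subr0.
(* The differences are defined over M but the homotopy lives on Q; along a lift of the path,
   continuity of the square [G] becomes that of a quotient. *)
have [l sl] := singular_lift Q s.
pose G (p : R * R) := D p.1 (s (segment v0 v1 p.2)).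
have cG : continuous G.
  move=> p.
  have cl : {for p, continuous (fun p : R * R => l (segment v0 v1 p.2))}.
    apply: (@continuous_comp _ _ _ snd (fun b => l (segment v0 v1 b)));
      first exact: cvg_snd.
    apply: (@continuous_comp _ _ _ (segment v0 v1)); first exact:
      segment_continuous.
    exact: singular_continuous.
  apply: (@continuous_ext _ _ (fun p : R * R =>
    rdiv (phi (l (segment v0 v1 p.2))) (Hc (p.1, l (segment v0 v1 p.2))))).
    by move=> q; rewrite -DE sl.
  apply: rdiv_continuous.
  - exact: (continuous_comp cl (@covering_continuous _ _ _ _ _ _ cphi _)).
  - apply: (@continuous_comp _ _ _ (fun p : R * R =>
      (p.1, l (segment v0 v1 p.2)))); last exact: cHc.
    by apply: continuous_pair => //; exact: cvg_fst.
  - apply: (@nearW _ (nbhs p)) => q.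
    by rewrite (covering_proj cphi) (covering_proj (cov _)).
pose ka (e : singular R 1 (circle R)) := incr e.
have ka0 (t : singular R 2 (circle R)) : (forall a, exists p, t a = G p) ->
  rcob ka t = 0.
  by move=> _; exact: (incr_face_sum (@singular_continuous _ _ _ t)).
have top : ka (edge cG (1, 0) (1, 1)) = incr (diff phi psi \o s).
  congr incr; apply/funext => t; rewrite /edge singE /G /= !mulr1 mulr0 add0r.
  by rewrite coord1_sum segment_coord /D clamp01_1 H1.
have bottom : ka (edge cG (0, 0) (0, 1)) = 0.
  rewrite /ka (@incrE _ _ (fun=> 0)) ?subrr//.
    by move=> t; exact: continuous_real_cst.
  move=> t; rewrite /edge singE /G /= !mulr0 !addr0 /D clamp01_0 H0.
  by rewrite /diff rdivqq to_circle0.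
have side (b : R) (c : 'I_2) : b = c%:R -> ka (edge cG (0, b) (1,
  b)) = w (s (vertex R c)).
  move=> bc; congr incr; apply/funext => t.
  rewrite /edge singE /G /= mulr0 add0r mulr1 -mulrDl coord1_sum mul1r.
  congr (D _ (s _)); rewrite bc; case: c bc => -[|[|[]]]//= c2 _.
    by rewrite segment0; congr vertex; exact: val_inj.
  by rewrite segment1; congr vertex; exact: val_inj.
have := edge_trans cG ka0 (0, 0) (1, 0) (1, 1).
rewrite (edge_trans cG ka0 (0, 0) (0, 1) (1, 1)) top bottom.
rewrite (side 0 0)// (side 1 1)// => h.
by rewrite -[(0 : cochain R M 1) s]/(0 : int) addr0; lra.
Qed.

(** A continuous logarithm [w] of the difference can be scaled: rotation by [t * w] moves [phi] to
    [psi] through coverings. *)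
Lemma has_class0_homotopic phi psi : locally_contractible R M ->
  fiberwise_covering n phi -> fiberwise_covering n psi ->
  has_class (diff phi psi) 0 -> covering_homotopic n phi psi.
Proof.
move=> Mlc cphi cpsi /(has_class0_log Mlc (diff_continuous cphi cpsi))[w cw wE].
exists (fun t q => rot (to_circle (t * w (proj q))) (phi q)); split.
- apply: continuous_subspaceT => p.
  apply: (rot_continuous_at (a := fun p : R * Q =>
    to_circle (p.1 * w (proj p.2)))
    (v := fun p : R * Q => phi p.2)).
    apply: (@continuous_to_circle _ _ (fun p : R * Q => p.1 * w (proj p.2))).
    apply: (@continuous_realM _ _ (fun p : R * Q => p.1)); first exact: cvg_fst.
    apply: (@continuous_comp _ _ _ snd (fun q => w (proj q))); first exact:
      cvg_snd.
    exact: (continuous_comp (@proj_continuous _ _ Q _) (@cw _)).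
  apply: (@continuous_comp _ _ _ snd); first exact: cvg_snd.
  exact: (covering_continuous cphi).
- move=> t _; apply: (@rotate_covering phi (fun x => to_circle (t * w x))) =>
    // x.
  apply: (@continuous_to_circle _ _ (fun x => t * w x)).
  exact: (continuous_realM (@continuous_real_cst _ _ t x) (@cw x)).
- by apply/funext => q; rewrite mul0r to_circle0 rot0.
- by apply/funext => q; rewrite mul1r wE (rot_diff _ cphi cpsi).
Qed.

Lemma covering_homotopicP phi psi : locally_contractible R M ->
  fiberwise_covering n phi -> fiberwise_covering n psi ->
  covering_homotopic n phi psi <-> has_class (diff phi psi) 0.
Proof.
move=> Mlc cphi cpsi; split; first exact: homotopic_has_class0.
exact: has_class0_homotopic.
Qed.

Lemma covering_homotopic_end phi psi : covering_homotopic n phi psi ->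
  fiberwise_covering n psi.
Proof. by move=> [H [_ covH _ <-]]; apply: covH; rewrite lexx ler01. Qed.

Lemma covering_homotopic_refl phi : locally_contractible R M ->
  fiberwise_covering n phi -> covering_homotopic n phi phi.
Proof.
move=> Mlc cphi; apply/(covering_homotopicP Mlc cphi cphi).
rewrite (_ : diff phi phi = fun=> 0); last by apply/funext => x; exact: rdivqq.
exists (fun=> 0); split=> [x|s]; first exact: to_circle0.
rewrite (@incrE _ _ (fun=> 0)) ?subrr ?add0r//.
- by move=> t; exact: continuous_real_cst.
- by move=> t; exact: to_circle0.
Qed.

(** Symmetry and transitivity follow from additivity of the class of a difference, without reversing
    or concatenating homotopies. *)
Lemma covering_homotopic_class phi psi : locally_contractible R M ->
  fiberwise_covering n phi -> covering_homotopic n phi psi ->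
  [set chi | covering_homotopic n phi chi] = [set chi |
    covering_homotopic n psi chi].
Proof.
move=> Mlc cphi phipsi; have cpsi := covering_homotopic_end phipsi.
have cd := diff_continuous cphi cpsi.
have d0 := (covering_homotopicP Mlc cphi cpsi).1 phipsi.
apply/seteqP; split=> chi /= h; have cchi := covering_homotopic_end h.
  apply/(covering_homotopicP Mlc cpsi cchi).
  have := has_classB (diff_continuous cphi cchi) cd
    ((covering_homotopicP Mlc cphi cchi).1 h) d0.
  rewrite subr0; congr has_class; apply/funext => x.
  by rewrite (diffD x cphi cpsi cchi) addrAC subrr add0r.
apply/(covering_homotopicP Mlc cphi cchi).
have := has_classD cd (diff_continuous cpsi cchi) d0
  ((covering_homotopicP Mlc cpsi cchi).1 h).
by rewrite addr0; congr has_class; apply/funext => x; rewrite -diffD.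
Qed.

End Coverings.

(** * Construction of a covering from matched sections *)

Section CoveringExists.
Variables (R : realType) (M : topologicalType) (n : nat).
Variables (Q P : circle_bundle R M).
Hypotheses (Mlc : locally_contractible R M) (Mc : compact [set: M])
  (Mh : hausdorff_space M).
Local Notation v0 := (vertex R (0 : 'I_2)).
Local Notation v1 := (vertex R (1 : 'I_2)).

Variables (l0 : singular R 0 M -> singular R 0 Q)
  (l1 : singular R 1 M -> singular R 1 Q)
  (l0' : singular R 0 M -> singular R 0 P)
  (l1' : singular R 1 M -> singular R 1 P) (c : cochain R M 2).
Hypotheses (sl : skeleton_section l0 l1) (sl' : skeleton_section l0' l1')
  (lc : is_obstruction l1 c) (lc' : is_obstruction l1' (c *+ n)).

Let e x := l0 (const_simplex R 0 x) (vertex R 0).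
Let e' x := l0' (const_simplex R 0 x) (vertex R 0).

Let proj_e x : proj (e x) = x.
Proof. exact: section_lift0 sl _ _. Qed.

Let proj_e' x : proj (e' x) = x.
Proof. exact: section_lift0 sl' _ _. Qed.

(** The covering [e x |-> e' x] of the fibers over [x], measured against the
    covering [sigma x |-> tau x] given by local sections. *)
Let discrepancy (sigma : M -> Q) (tau : M -> P) x :=
  rdiv (tau x) (e' x) - rdiv (sigma x) (e x) *+ n.

(** The same comparison along a path, with the continuous [l1 s] and [l1' s] in place of [e] and
    [e']; it is a real refinement of the change of [discrepancy] between the endpoints. *)
Let transport (sigma : M -> Q) (tau : M -> P) (s : singular R 1 M) :=
  incr (fun t => rdiv (tau (s t)) (l1' s t) - rdiv (sigma (s t)) (l1 s t) *+ n).

Section Local.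
Variables (B : set M) (sigma : M -> Q) (tau : M -> P).
Hypotheses (sigma_cont : forall y, B y -> {for y, continuous sigma})
  (tau_cont : forall y, B y -> {for y, continuous tau})
  (sigmaK : forall y, B y -> proj (sigma y) = y)
  (tauK : forall y, B y -> proj (tau y) = y).

Let l1P : forall s, is_lift s (l1 s) := section_lift1 sl.
Let l1P' : forall s, is_lift s (l1' s) := section_lift1 sl'.

Lemma sigma_part_continuous (s : singular R 1 M) : (forall t, B (s t)) ->
  continuous (fun t => rdiv (sigma (s t)) (l1 s t)).
Proof.
move=> sB t; apply: rdiv_continuous; last first.
- by apply: (@nearW _ (nbhs t)) => t'; rewrite sigmaK// l1P.
- exact: singular_continuous.
- exact: (continuous_on_path sigma_cont sB).
Qed.

Lemma tau_part_continuous (s : singular R 1 M) : (forall t, B (s t)) ->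
  continuous (fun t => rdiv (tau (s t)) (l1' s t)).
Proof.
move=> sB t; apply: rdiv_continuous; last first.
- by apply: (@nearW _ (nbhs t)) => t'; rewrite tauK// l1P'.
- exact: singular_continuous.
- exact: (continuous_on_path tau_cont sB).
Qed.

Lemma transportE (s : singular R 1 M) : (forall t, B (s t)) ->
  transport sigma tau s = incr (fun t => rdiv (tau (s t)) (l1' s t)) -
    incr (fun t => rdiv (sigma (s t)) (l1 s t)) *+ n.
Proof.
move=> sB; have cs := sigma_part_continuous sB.
rewrite /transport (@incrB _ _ (fun t => rdiv (sigma (s t)) (l1 s t) *+ n)).
- by rewrite incrMn.
- exact: tau_part_continuous.
- by move=> t; exact: (continuous_circleMn (n := n) (@cs t)).
Qed.

Lemma transport_continuous (s : singular R 1 M) : (forall t, B (s t)) ->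
  continuous (fun t => rdiv (tau (s t)) (l1' s t) - rdiv (sigma (s t)) (l1 s t)
    *+ n).
Proof.
move=> sB t; apply: (continuous_circleB (@tau_part_continuous _ sB t)).
exact: (continuous_circleMn (n := n) (@sigma_part_continuous _ sB t)).
Qed.

Lemma to_circle_transport (s : singular R 1 M) : (forall t, B (s t)) ->
  to_circle (transport sigma tau s) =
  discrepancy sigma tau (s v1) - discrepancy sigma tau (s v0).
Proof.
move=> sB; rewrite incr_to_circle; last exact: transport_continuous.
by rewrite !(section_vertex sl) !(section_vertex sl').
Qed.

(** The local sections lift a triangle to Q and to P, where [transport] is the transgression in P
    minus [n] times that in Q. Its coboundary is the obstruction [c *+ n] minus [n] times [c]. *)
Lemma transport_cocycle : cocycle_on B (transport sigma tau).
Proof.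
move=> s sB.
pose mQ : singular R 2 Q := sing (continuous_on_path sigma_cont sB).
pose mP : singular R 2 P := sing (continuous_on_path tau_cont sB).
have mQs : sproj mQ = s by apply: sproj_lift => t; rewrite singE /= sigmaK.
have mPs : sproj mP = s by apply: sproj_lift => t; rewrite singE /= tauK.
have /(is_obstructionP l1P) /(_ mQ) := lc; rewrite mQs => cQ.
have /(is_obstructionP l1P') /(_ mP) := lc'; rewrite mPs => cP.
have : rcob (transgression l1') mP - rcob (transgression l1) mQ *+ n = 0.
  rewrite -cQ -cP (_ : (c *+ n) s = c s *+ n); first
    by rewrite rmorphMn /= subrr.
  by rewrite natmulfctE.
move=> <-; rewrite /rcob -sumrMnl -sumrB; apply: eq_bigr => i _.
rewrite -mulrnAr -mulrBr transportE; last by move=> t; rewrite faceE.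
congr (_ * (_ - _ *+ n)).
  by rewrite (@transgressionE _ _ _ _ (face i s))// => t;
    rewrite faceE singE /= tauK.
by rewrite (@transgressionE _ _ _ _ (face i s))// => t;
  rewrite faceE singE /= sigmaK.
Qed.

End Local.

Lemma covering_of_sections : exists phi : Q -> P, fiberwise_covering n phi.
Proof.
have loc x : exists Bstu : (set M * (M -> Q)) * ((M -> P) * (M -> R)),
    let: ((B, sigma), (tau, u)) := Bstu in
    [/\ open B /\ B x,
      forall y, B y -> {for y, continuous sigma} /\ {for y, continuous tau},
      forall y, B y -> proj (sigma y) = y /\ proj (tau y) = y,
      forall s : singular R 1 M, (forall t, B (s t)) ->
        transport sigma tau s = u (s v1) - u (s v0) &
      forall y, B y -> to_circle (u y) = discrepancy sigma tau y].
  have [U [sigma [oU Ux cs sK]]] := @bundle_sectionable R M Q x.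
  have [V [tau [oV Vx ct tK]]] := @bundle_sectionable R M P x.
  have [B [C [oB Bx BUV BC]]] := Mlc (openI oU oV) (conj Ux Vx).
  have cs' y : B y -> {for y, continuous sigma} by move=> /BUV[/cs].
  have ct' y : B y -> {for y, continuous tau} by move=> /BUV[_ /ct].
  have sK' y : B y -> proj (sigma y) = y by move=> /BUV[/sK].
  have tK' y : B y -> proj (tau y) = y by move=> /BUV[_ /tK].
  have [u uP] := contraction_potential Bx BC (transport_cocycle cs' ct' sK'
    tK').
  have [r rP] := to_circle_surj (discrepancy sigma tau x).
  (* The constant [r] makes the potential a logarithm of [discrepancy] at [x]; paths from [x]
     propagate this to all of [B]. *)
  exists ((B, sigma), (tau, fun y => u y - u x + r)); split=> //.
  - by move=> y By; split; [exact: cs'|exact: ct'].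
  - by move=> y By; split; [exact: sK'|exact: tK'].
  - by move=> s sB; rewrite (uP _ sB); ring.
  - move=> y By; have [s [sB s0 s1]] := contraction_path BC By.
    rewrite raddfD /= rP -{1}s0 -{1}s1 -(uP _ sB).
    by rewrite (to_circle_transport cs' ct' sK' tK' sB) s0 s1 subrK.
pose B x := (sval (cid (loc x))).1.1; pose sigma x := (sval (cid (loc x))).1.2.
pose tau x := (sval (cid (loc x))).2.1; pose u x := (sval (cid (loc x))).2.2.
have locP x : [/\ open (B x) /\ B x x,
    forall y, B x y -> {for y, continuous (sigma x)} /\
      {for y, continuous (tau x)},
    forall y, B x y -> proj (sigma x y) = y /\ proj (tau x y) = y,
    forall s : singular R 1 M, (forall t, B x (s t)) ->
      transport (sigma x) (tau x) s = u x (s v1) - u x (s v0) &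
    forall y, B x y -> to_circle (u x y) = discrepancy (sigma x) (tau x) y].
  by rewrite /B /sigma /tau /u; case: cid => -[[? ?] [? ?]].
have [||U UP] := gluing (R := R) (B := B) (u := u) Mc Mh.
- by move=> x; have [] := locP x.
- move=> x y q Bxq Byq.
  have [[oBx _] cx px ux _] := locP x; have [[oBy _] cy py uy _] := locP y.
  (* In the difference of the two transports the sections [l1] and [l1'] cancel, leaving the
     increment of this continuous transition map. *)
  pose h p := rdiv (tau x p) (tau y p) - rdiv (sigma x p) (sigma y p) *+ n.
  have ch p : (B x `&` B y) p -> {for p, continuous h}.
    move=> [Bxp Byp].
    have nB : \forall p \near p, B x p /\ B y p.
      by apply: filterI; exact: open_nbhs_nbhs.
    apply: (@continuous_circleB _ _ (fun p => rdiv (tau x p) (tau y p))).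
      apply: rdiv_continuous; [exact: (cx _ Bxp).2|exact: (cy _ Byp).2|].
      by apply: filterS nB => p' [/px[_ ->] /py[_ ->]].
    apply: (@continuous_circleMn _ _ (fun p => rdiv (sigma x p) (sigma y p))).
    apply: rdiv_continuous; [exact: (cx _ Bxp).1|exact: (cy _ Byp).1|].
    by apply: filterS nB => p' [/px[-> _] /py[-> _]].
  apply: (@potential_continuous R M Mlc (B x `&` B y) h) => //; first exact:
    openI.
  move=> s sB.
  have sBx t : B x (s t) by exact: (sB t).1.
  have sBy t : B y (s t) by exact: (sB t).2.
  transitivity (transport (sigma x) (tau x) s - transport (sigma y) (tau y) s);
    last first.
    by rewrite (ux _ sBx) (uy _ sBy); ring.
  rewrite /transport -incrB.
  + congr incr; apply/funext => t; rewrite /h /=.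
    have [xs xt] := px _ (sBx t); have [ys yt] := py _ (sBy t).
    rewrite (@rdivD _ _ _ (tau x (s t)) (tau y (s t)) (l1' s t)) ?xt ?yt
      ?(section_lift1 sl')//.
    rewrite (@rdivD _ _ _ (sigma x (s t)) (sigma y (s t)) (l1 s t)) ?xs ?ys
      ?(section_lift1 sl)//.
    have cancel (a b a' b' : circle R) : a + b - (a' + b') - (b - b') = a - a'.
      by rewrite opprD addrACA addrK.
    by rewrite mulrnDl cancel.
  + apply: (transport_continuous (B := B x)) => // p;
      [move=> /cx[]|move=> /cx[]|
      move=> /px[]|move=> /px[]]; by [].
  + apply: (transport_continuous (B := B y)) => // p;
      [move=> /cy[]|move=> /cy[]|
      move=> /py[]|move=> /py[]]; by [].
pose coef q := rdiv (e (proj q)) q *+ n - to_circle (U (proj q)).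
pose phi (q : Q) : P := rot (coef q) (e' (proj q)).
(* Written through the local sections, the discontinuities of [e] and [e'] are absorbed in [u x],
   and those of [u x] cancel against [U]. *)
have phiE x q : B x (proj q) -> phi q =
    rot (rdiv (sigma x (proj q)) q *+ n + to_circle (u x (proj q) - U (proj q)))
      (tau x (proj q)).
  move=> Bq; have [_ _ px _ ux] := locP x; have [ps pt] := px _ Bq.
  rewrite /phi -[e' _](rdivK (q := tau x (proj q))) ?proj_e' ?pt// -rotD;
    congr rot.
  rewrite raddfB /= (ux _ Bq) /coef /discrepancy.
  rewrite (@rdivD _ _ _ (sigma x (proj q)) (e (proj q)) q) ?ps ?proj_e//.
  set S := rdiv _ (e _); set E := rdiv (e _) q; set D := rdiv _ (e' _).
  rewrite mulrnDl [S *+ n + _]addrC -[RHS]addrA [D - _]addrC -[_ + D - _]addrA.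
  by rewrite addNKr addrA addrAC.
exists phi; split.
- move=> q; have [[oB Bq] cB pB _ _] := locP (proj q).
  have cproj := @proj_continuous _ _ Q q.
  apply: (@continuous_near_eq _ _ (fun q' => rot (rdiv (sigma (proj q) (proj
    q')) q' *+ n +
     to_circle (u (proj q) (proj q') - U (proj q'))) (tau (proj q) (proj q')))).
    have : \forall q' \near q, B (proj q) (proj q').
      exact: (continuous_open_near cproj oB).
    by apply: filterS => q' Bq'; rewrite -phiE.
  apply: (rot_continuous_at (a := fun q' => rdiv (sigma (proj q) (proj q')) q'
    *+ n +
     to_circle (u (proj q) (proj q') - U (proj q')))); last first.
    exact: (continuous_comp cproj (cB _ Bq).2).
  apply: (@continuous_circleD _ _ (fun q' => rdiv (sigma (proj q) (proj q')) q'
    *+ n)).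
    apply: (@continuous_circleMn _ _ (fun q' =>
      rdiv (sigma (proj q) (proj q')) q')).
    apply: rdiv_continuous.
    - exact: (continuous_comp cproj (cB _ Bq).1).
    - exact: cvg_id.
    - have : \forall q' \near q, B (proj q) (proj q').
        exact: (continuous_open_near cproj oB).
      by apply: filterS => q' /pB[].
  apply: (continuous_to_circle (w := fun q' =>
    u (proj q) (proj q') - U (proj q'))).
  exact: (continuous_comp cproj (UP _ _ Bq)).
- by move=> q; rewrite proj_rot proj_e'.
- move=> a q; rewrite /phi /coef proj_rot rdiv_rotr ?proj_e// mulrnDl -rotD.
  by rewrite addrCA addrA.
Qed.

End CoveringExists.

(** A torsor is described by its difference map: [g] sends [x] to the unique [y] with [D x y = g],
    and a base point [x0] turns differences into a bijection. *)
Lemma torsor_action (G : zmodType) (X : Type) (x0 : X) (D : X -> X -> G) :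
  (forall x y z, D x z = D x y + D y z) -> (forall x y, D x y = 0 -> x = y) ->
  (forall x g, exists y, D x y = g) ->
  (exists act : G -> X -> X, simply_transitive_action act) /\
  (exists f : X -> G, bijective f).
Proof.
move=> DD D0 Dsurj.
have Dinj x y z : D x y = D x z -> y = z.
  by rewrite (DD x y z) => /esym/eqP; rewrite -subr_eq0 addrAC subrr add0r =>
    /eqP/D0.
have Dxx x : D x x = 0 by apply: (addrI (D x x)); rewrite addr0 -DD.
pose act g x := sval (cid (Dsurj x g)).
have actP g x : D x (act g x) = g by rewrite /act; case: cid.
split; last first.
  by exists (D x0), (act^~ x0) => [x|g]; [apply: (Dinj x0)|]; rewrite actP.
exists act; split=> [x|g h x|x y].
- by apply: (Dinj x); rewrite actP Dxx.
- by apply: (Dinj x); rewrite actP (DD x (act h x)) !actP addrC.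
- by exists (D x y); split=> [|g <-]; [apply: (Dinj x)|]; rewrite actP.
Qed.

Theorem theorem3p2 (R : realType) (d : nat) (M : topologicalType)
    (M_closed : closed_manifold R d M)
    (mu : M -> singular R d M -> int) (M_oriented : orientation mu)
    (Q P : circle_bundle R M) (n : nat) (n_gt0 : (0 < n)%N) :
  (Cov n Q P !=set0 <-> euler_class Q *+ n = euler_class P) /\
  (Cov n Q P !=set0 ->
     (exists act : cohomology R M 1 -> Cov n Q P -> Cov n Q P,
        simply_transitive_action act) /\
     (exists f : Cov n Q P -> cohomology R M 1, bijective f)).
Proof.
have Mlc := manifold_locally_contractible M_closed.
have [Mc Mh _ _] := M_closed.
split.
  split=> [[A [phi cphi _]]|]; first exact: covering_euler cphi.
  move=> /matched_sections[l0 [l1 [l0' [l1' [c [sl sl' lc lc']]]]]].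
  have [phi cphi] := covering_of_sections Mlc Mc Mh sl sl' lc lc'.
  by exists [set psi | covering_homotopic n phi psi]; exists phi.
move=> [A0 CA0].
have repP (A : Cov n Q P) : exists phi, fiberwise_covering n phi /\
    val A = [set psi | covering_homotopic n phi psi].
  by have [phi cphi AE] := set_valP A; exists phi.
pose rep A := sval (cid (repP A)).
have crep A : fiberwise_covering n (rep A) by rewrite /rep; case: cid => ? [].
have valE A : val A = [set psi | covering_homotopic n (rep A) psi].
  by rewrite /rep; case: cid => ? [].
have cd A A' : continuous (diff (rep A) (rep A')) by exact:
  (@diff_continuous _ _ n).
have zP A A' : exists z : cocycle R M 1,
  has_class (diff (rep A) (rep A')) (val z).
  have [z zc] := has_class_exists (@cd A A').
  by exists (Cocycle (has_class_cocycle (@cd A A') zc)).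
pose z A A' := sval (cid (zP A A')).
have zE A A' : has_class (diff (rep A) (rep A')) (val (z A A')).
  by rewrite /z; case: cid.
apply: (@torsor_action _ _ (exist (fun A => A \in Cov n Q P) A0 (mem_set CA0))
  (fun A A' => cohomology_class (z A A'))).
- move=> A A' A''.
  rewrite -[RHS](raddfD (\pi_(Quotient.quot (@is_coboundary R M 1)))%qT).
  apply/cohomology_class_eq; apply: (has_class_eq (zE A A'')).
  have := has_classD (@cd A A') (@cd A' A'') (zE A A') (zE A' A'').
  rewrite [X in has_class _ X -> _](_ : _ = val (z A A' + z A' A'')) ?raddfD//.
  congr has_class; apply/funext => x; symmetry; exact: (@diffD _ _ n).
- move=> A A' zAA'.
  have [b zb] : exists b : cochain R M 0, val (z A A') - val (0 :
    cocycle R M 1) = coboundary b.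
    apply/cohomology_class_eq; rewrite zAA'.
    by rewrite [RHS](raddf0 (\pi_(Quotient.quot (@is_coboundary R M 1)))%qT).
  have z0 : has_class (diff (rep A) (rep A')) 0.
    (* The cocycle is the coboundary of [b]; changing the logarithm by [b] turns it into the zero
       cochain, not just a cochain of class zero. *)
    have := has_class_coboundary (0 - b) (zE A A').
    by rewrite coboundaryB coboundary0 -zb /= sub0r subr0 subrr.
  apply: val_inj; rewrite [LHS]valE [RHS]valE.
  apply: covering_homotopic_class => //.
  exact/(covering_homotopicP Mlc (crep A) (crep A')).
- move=> A g; pose y : cocycle R M 1 := repr (g :
    Quotient.quot (@is_coboundary R M 1)).
  have yg : cohomology_class y = g by rewrite /cohomology_class reprK.
  have y0 : coboundary (val y) = 0 by have /asboolP := valP y.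
  have [f cf fy] := has_class_surj Mlc Mc Mh y0.
  have cpsi := rotate_covering (crep A) cf.
  set psi := (fun q => _) in cpsi.
  have CA' : Cov n Q P [set chi | covering_homotopic n psi chi] by exists psi.
  exists (exist (fun A => A \in Cov n Q P) _ (mem_set CA')); set A' :=
    exist _ _ _.
  rewrite -yg; apply/cohomology_class_eq; apply: (has_class_eq (zE A A')).
  (* The representative chosen for [A'] need not be [psi]. It is homotopic to it, so the extra
     difference contributes the class 0. *)
  have psiA' : covering_homotopic n psi (rep A').
    have : val A' (rep A') by rewrite valE; exact: covering_homotopic_refl.
    by [].
  have := has_classD cf (diff_continuous cpsi (crep A')) fy
    ((covering_homotopicP Mlc cpsi (crep A')).1 psiA').
  rewrite addr0; congr has_class; apply/funext => x.
  by rewrite (diffD x (crep A) cpsi (crep A')) diff_rotate.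
Qed.
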